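(* Let $p$ be a prime and let $\mathcal{F}$ be a saturated fusion system on a finite $p$-group $P$. If (1) $p$ is odd and $P$ is slim, or (2) $p = 2$ and $P$ is $D_8$-free, then $\mathcal{F} = \mathcal{F}_P(P)$ if and only if $\mathrm{N}_{\mathcal F}(P) = \mathcal{F}_P(P)$.
   Context: Slim $p$-groups. Let $C_n$ denote the cyclic group of order $n$. Set $Y_1=C_p\wr C_p$ and for $m>1$ let $Y_m$ be the pull-back of the canonical projection $C_p\wr C_p\to C_p$ (onto the top group of the wreath product) and the surjection $C_{p^m}\to C_p$. A finite $p$-group $P$ is slim if, for all $m\ge1$, no subgroup of $P$ is isomorphic to $Y_m$. A finite group is $D_8$-free if no section (quotient of a subgroup) of it is isomorphic to the dihedral group $D_8$ of order $8$. Fusion systems. Let $\mathcal{F}$ be a category whose objects are the subgroups of $P$, where $\mathrm{Hom}_{\mathcal F}(Q,R)$ is a set of injective group homomorphisms $Q\to R$ and composition is composition of maps. Write $Q^{\mathcal F}$ for the $\mathcal F$-isomorphism class of $Q$, $\mathrm{Hom}_P(Q,R)$ for the homomorphisms $Q\to R$ induced by conjugation by elements of $P$, and $\mathrm{Aut}_P(Q)$ for the automorphisms of $Q$ induced by conjugation by elements of $\mathrm N_P(Q)$. A subgroup $Q$ is fully $\mathcal F$-normalized if $|\mathrm N_P(Q)|\ge|\mathrm N_P(R)|$ for all $R\in Q^{\mathcal F}$. $\mathcal F$ is a saturated fusion system on $P$ if for all $Q,R\le P$: (a) if $Q\le R$, the inclusion $Q\to R$ is in $\mathcal F$; (b) if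 $\phi\in\mathrm{Hom}_{\mathcal F}(Q,R)$, then the induced isomorphism $Q\to\phi(Q)$ and its inverse are in $\mathcal F$; (c) $\mathrm{Hom}_P(Q,R)\subseteq\mathrm{Hom}_{\mathcal F}(Q,R)$; (d) $\mathrm{Aut}_P(P)$ is a Sylow $p$-subgroup of $\mathrm{Aut}_{\mathcal F}(P)$; (e) every $\phi\in\mathrm{Hom}_{\mathcal F}(Q,P)$ with $\phi(Q)$ fully $\mathcal F$-normalized extends to a morphism in $\mathrm{Hom}_{\mathcal F}(N_\phi,P)$, where $N_\phi$ is the inverse image in $\mathrm N_P(Q)$ of $\mathrm{Aut}_P(Q)\cap(\phi^{-1}\mathrm{Aut}_P(\phi(Q))\phi)$. $\mathcal F_P(P)$ is the fusion system on $P$ whose morphisms are exactly those in $\mathrm{Hom}_P(Q,R)$, $Q,R\le P$. For $Q\le P$, $\mathrm N_{\mathcal F}(Q)$ has objects the subgroups of $\mathrm N_P(Q)$ and morphisms $R\to S$ those $\phi\in\mathrm{Hom}_{\mathcal F}(R,S)$ for which there is $\varphi\in\mathrm{Hom}_{\mathcal F}(QR,QS)$ with $\varphi|_R=\phi$ and $\varphi(Q)=Q$. *)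

(* Defs.v *)
From mathcomp Require Import all_boot all_algebra all_fingroup all_solvable.

Set Implicit Arguments.
Unset Strict Implicit.
Unset Printing Implicit Defensive.

Local Open Scope group_scope.

Section Wreath.

Variables aT bT : finGroupType.

Definition wr_base : finGroupType := {dffun forall _ : bT, aT}.

Definition wr_shift (f : wr_base) (b : bT) : wr_base := [ffun i => f (b * i)].

Lemma wr_shift_is_action : is_action [set: bT] wr_shift.
Proof.
split=> [b f g /ffunP e | f a b _ _]; apply/ffunP => i.
  by have := e (b^-1 * i); rewrite !ffunE mulKVg.
by rewrite !ffunE mulgA.
Qed.

Canonical wr_action := Action wr_shift_is_action.

Lemma wr_shift_is_groupAction : is_groupAction [set: wr_base] wr_action.
Proof.
move=> b _; rewrite inE; apply/andP; split.
  by apply/subsetP => f _; rewrite inE.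
apply/morphicP => f g _ _; rewrite !actpermE; apply/ffunP => i.
by rewrite !ffunE.
Qed.

Canonical wr_groupAction := GroupAction wr_shift_is_groupAction.

(* The regular wreath product of aT by bT; an element is a pair (b, f) with b
   in the top group bT and f in the base group of functions bT -> aT. *)
Definition wreath : finGroupType := sdprod_by wr_groupAction.

Definition wr_top (w : wreath) : bT := w.1.

Lemma wr_topM : {morph wr_top : u v / u * v}.
Proof. by []. Qed.

End Wreath.

Definition pullback (aT bT cT : finGroupType) (f : aT -> cT) (g : bT -> cT) :
  {set aT * bT} := [set u | f u.1 == g u.2].

Lemma pullback_group_set (aT bT cT : finGroupType) (f : aT -> cT)
    (g : bT -> cT) :
    {morph f : x y / x * y} -> {morph g : x y / x * y} ->
  group_set (pullback f g).
Proof.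
have morph_1 (dT : finGroupType) (h : dT -> cT) :
  {morph h : x y / x * y} -> h 1 = 1.
  by move=> hM; apply: (mulgI (h 1)); rewrite -hM !mulg1.
move=> fM gM; apply/group_setP; split=> [|u v]; first by rewrite inE !morph_1.
by rewrite !inE => /eqP fg_u /eqP fg_v; rewrite fM gM fg_u fg_v.
Qed.

(* Reduction of residues modulo q to residues modulo d; it is a morphism of
   additive groups when d divides q. *)
Definition Zp_red (q d : nat) (x : 'Z_q) : 'Z_d := inZp x.

Lemma Zp_redM (q d : nat) : 1 < d -> 1 < q -> d %| q ->
  {morph @Zp_red q d : x y / x * y}.
Proof.
move=> d_gt1 q_gt1 d_q x y; apply: val_inj.
have d_q' : (Zp_trunc d).+2 %| (Zp_trunc q).+2 by rewrite !Zp_cast.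
by rewrite /= modn_dvdm // modnDm.
Qed.

Lemma Zp_red_surj (q d : nat) : 1 < d -> 1 < q -> d %| q ->
  forall y : 'Z_d, exists x : 'Z_q, Zp_red d x = y.
Proof.
move=> d_gt1 q_gt1 d_q y; exists (inZp y); apply: val_inj.
have d_q' : (Zp_trunc d).+2 %| (Zp_trunc q).+2 by rewrite !Zp_cast.
by rewrite /= modn_dvdm // modn_small.
Qed.

(* The groups Y_m for m > 1. *)
Definition Ypull (p m : nat) : {set wreath 'Z_p 'Z_p * 'Z_(p ^ m)} :=
  pullback (@wr_top 'Z_p 'Z_p) (@Zp_red (p ^ m) p).

Section Groups.

Variable gT : finGroupType.
Implicit Types P Q R S : {group gT}.

Definition slim (p : nat) P : Prop :=
  forall Q, Q \subset P ->
    ~ Q \isog [set: wreath 'Z_p 'Z_p]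
    /\ (forall m : nat, 1 < m -> ~ Q \isog Ypull p m).

Definition D8_free P : Prop :=
  forall Q R, Q \subset P -> R <| Q -> ~ Q / R \isog 'D_8.

(* A morphism Q -> R is represented by a function gT -> gT of which only the
   values on Q matter (see fcat_ext below), and F Q R is the set
   Hom_F(Q, R). *)
Definition hom_system := {group gT} -> {group gT} -> pred (gT -> gT).

Implicit Types (F : hom_system) (f g : gT -> gT).

Record injhom Q R f : Prop := InjHom {
  injhomM : {in Q &, {morph f : x y / x * y}};
  injhom_inj : {in Q &, injective f};
  injhom_sub : f @: Q \subset R
}.

Record fusion_category P F : Prop := FusionCategory {
  fcat_ext : forall Q R f g, Q \subset P -> R \subset P ->
    {in Q, f =1 g} -> F Q R f = F Q R g;
  fcat_injhom : forall Q R f, Q \subset P -> R \subset P ->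
    F Q R f -> injhom Q R f;
  fcat_id : forall Q, Q \subset P -> F Q Q id;
  fcat_comp : forall Q R S f g, Q \subset P -> R \subset P -> S \subset P ->
    F Q R f -> F R S g -> F Q S (g \o f)
}.

(* Categories with objects the subgroups of P and of P' respectively. *)
Definition eq_category P F P' F' : Prop :=
  P :=: P' /\
  forall Q R f, Q \subset P -> R \subset P -> F Q R f = F' Q R f.

Definition F_iso F Q R : Prop :=
  exists f g, [/\ F Q R f, F R Q g, {in Q, cancel f g} & {in R, cancel g f}].

Definition fully_normalized P F Q : Prop :=
  forall R, R \subset P -> F_iso F Q R -> #|'N_P(R)| <= #|'N_P(Q)|.

(* Hom_P(Q, R); thus Hom_P P is also the fusion system F_P(P). *)
Definition Hom_P P : hom_system := fun Q R f =>
  [exists x in P, (Q :^ x \subset R) && [forall u in Q, f u == u ^ x]].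

Definition Aut_P P Q : {set {perm gT}} := conj_aut Q @* 'N_P(Q).

Definition Aut_F F Q : {set {perm gT}} := [set a in Aut Q | F Q Q a].

(* The image f(Q), as a group; the generation is only there to provide the
   group structure. *)
Definition img f Q : {group gT} := [group of <<f @: Q>>].

Lemma imgE f Q : {in Q &, {morph f : x y / x * y}} -> img f Q :=: f @: Q.
Proof.
move=> fM; pose h := Morphism fM.
rewrite /img /= -[f @: Q]/(h @: Q) -(morphimEdom h) genGid //.
Qed.

(* f^-1 A f, for f an isomorphism from Q to f(Q) and A a set of
   automorphisms of f(Q). *)
Definition conj_Aut f Q (A : {set {perm gT}}) : {set {perm gT}} :=
  [set a in Aut Q | [exists b in A, [forall u in Q, f (a u) == b (f u)]]].

Definition N_phi_set P Q f : {set gT} :=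
  'N_P(Q) :&:
    conj_aut Q @*^-1 (Aut_P P Q :&: conj_Aut f Q (Aut_P P (img f Q))).

Lemma N_phi_group_set P Q f : group_set (N_phi_set P Q f).
Proof.
have cA_group (A : {group {perm gT}}) : group_set (conj_Aut f Q A).
  apply/group_setP; split=> [|a b].
    rewrite inE group1; apply/exists_inP; exists 1; first exact: group1.
    by apply/forall_inP => u _; rewrite !perm1.
  case/setIdP=> Aa /exists_inP[a' Aa' /forall_inP fa].
  case/setIdP=> Ab /exists_inP[b' Ab' /forall_inP fb].
  apply/setIdP; split; first exact: groupM.
  apply/exists_inP; exists (a' * b'); first exact: groupM.
  apply/forall_inP => u Qu; rewrite !permM (eqP (fb _ _)) ?(eqP (fa _ _)) //.
  by rewrite Aut_closed.
pose A := [group of Aut_P P (img f Q)].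
exact: (valP ('N_P(Q) :&: conj_aut Q @*^-1
  ([group of Aut_P P Q] :&: Group (cA_group A)))%G).
Qed.

Definition N_phi P Q f : {group gT} := Group (N_phi_group_set P Q f).

Record saturated (p : nat) P F : Prop := Saturated {
  sat_category : fusion_category P F;
  sat_incl : forall Q R, Q \subset P -> R \subset P -> Q \subset R -> F Q R id;
  sat_iso : forall Q R f, Q \subset P -> R \subset P -> F Q R f ->
    F Q (img f Q) f
    /\ (forall g, {in Q, cancel f g} -> F (img f Q) Q g);
  sat_conj : forall Q R f, Q \subset P -> R \subset P ->
    Hom_P P Q R f -> F Q R f;
  sat_Sylow : p.-Sylow(Aut_F F P) (Aut_P P P);
  sat_ext : forall Q f, Q \subset P -> F Q P f ->
    fully_normalized P F (img f Q) ->
    exists2 g, F (N_phi P Q f) P g & {in Q, g =1 f}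
}.

(* The morphisms of N_F(Q), to be considered on subgroups of N_P(Q); the join
   Q <*> R is then the product QR.  Quantifying over finite functions loses
   nothing, by fcat_ext. *)
Definition N_F F Q : hom_system := fun R S f =>
  F R S f &&
  [exists g : {ffun gT -> gT},
    [&& F (Q <*> R)%G (Q <*> S)%G g, [forall u in R, g u == f u]
      & g @: Q == Q]].

End Groups.

(* Main.v *)
Require Import Defs.
From mathcomp Require Import all_boot all_algebra all_fingroup all_solvable.
From mathcomp Require Import vcharacter.

Set Implicit Arguments.
Unset Strict Implicit.
Unset Printing Implicit Defensive.

Local Open Scope group_scope.

(** Only one implication has content: assume that every F-automorphism of P is
    inner, and that some F-morphism is not conjugation by an element of P.

    Choose such a morphism on a subgroup of largest possible order, and let R
    be a fully normalized subgroup isomorphic in F to its source.  Put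
    H = Aut_F(R), S = Aut_P(R) and I = Inn(R).  The extension axiom and the
    maximality of |R| show that an automorphism of H which conjugates into S
    the action of some x in N_P(R) outside R already lies in S
    (Aut_F_strongly_embedded).  If H = S, every F-isomorphism onto R extends
    to a larger subgroup, hence is a conjugation, against the choice of R.
    Otherwise H/I is a Frobenius group with complement S/I; its kernel and the
    Frattini argument give an abelian p'-subgroup A of H and y in N_P(R) \ R,
    with y^p in R, acting on A without nontrivial fixed points
    (strongly_embedded_coprime_action).

    It remains to find a forbidden subgroup or section inside R<y>.  If A acts
    on an abelian group without fixed points, the sum of w^a over all a <> 1
    in A is -w.  When y fixes w, this sum splits along the y-orbits of A into
    norms, a norm being the product of the p conjugates of an element under
    the powers of y.  So w is itself a norm (fix_norm), and if w <> 1 then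
    some w^a has nontrivial norm (norm_neq1).  The first fact lets one
    correct y by an element of Z(R) so that y^p is fixed by A
    (centralize_power).  The second is applied to a section E / C_E(A), where
    E <= R has derived subgroup fixed by A, and C_E(A) is central in E
    (class2_coprime_section): it yields v in E whose norm is not fixed by A.
    For p = 2 the images of y and v generate a dihedral section of order 8
    (free_orbit_D8).

    For p odd a subgroup is needed, so the conjugates of v must commute.
    Here v = w^a * w^(a^-1) does it: up to central factors the commutator of v
    with a conjugate is a product of values f(c) = [w, w^c], c in A, in which
    each f(c) meets f(c^-1) = f(c)^-1 (symmetrized_commute).  The norms of
    these elements still sum to -2w <> 0.  The group generated by the
    conjugates of v is then elementary abelian of rank p, permuted regularly
    by y, and meets <y> trivially because the elements of <y> in R are fixed
    by A; with #[y] = p^m this gives Y_m (Ypull_embed). *)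

(** * Fixed-point-free action of an element on a group *)

Lemma mem_exp_coprime (gT : finGroupType) (G : {group gT}) (y : gT) m n :
  0 < m -> coprime m n -> y ^+ m \in G -> y ^+ n \in G -> y \in G.
Proof.
move=> m_gt0 co_mn Gym Gyn; case: (egcdnP n m_gt0) => u v.
rewrite (eqP co_mn) => def_u _.
have: y ^+ (u * m) \in G by rewrite mulnC expgM groupX.
by rewrite def_u expgD expg1 groupMl // mulnC expgM groupX.
Qed.

Section FixedPointFree.

Variables (gT : finGroupType) (p : nat) (R : {group gT}) (y : gT).
Hypotheses (p_pr : prime p) (nRy : y \in 'N(R)) (cRyp : y ^+ p \in 'C(R)).
Hypothesis regRy : 'C_R[y] = 1.

(** Two equal conjugates make a commute with a power of y prime to p, besides
    y ^+ p, hence with y. *)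
Lemma fpf_orbit_inj a : a \in R^# ->
  {in 'I_p &, injective (fun i : 'I_p => a ^ (y ^+ i))}.
Proof.
case/setD1P=> nt_a Ra.
have wlog_inj (i j : 'I_p) : i < j -> a ^ (y ^+ i) = a ^ (y ^+ j) -> False.
  move=> lt_ij eq_ij; case/eqP: nt_a; apply/set1P; rewrite -set1gE -regRy.
  rewrite inE Ra /= -cent1C; apply: (@mem_exp_coprime _ _ _ (j - i) p).
  - by rewrite subn_gt0.
  - rewrite coprime_sym prime_coprime // gtnNdvd ?subn_gt0 //.
    exact: leq_ltn_trans (leq_subr _ _) (ltn_ord j).
  - apply/cent1P/commute_sym/commgP/conjg_fixP; apply: (conjg_inj (y ^+ i)).
    by rewrite -conjgM -expgD subnK // ltnW.
  - by apply/cent1P; apply: (centP cRyp).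
move=> i j _ _ eq_ij; apply: val_inj; case: (ltngtP i j) => // lt.
  by case: (wlog_inj i j).
by case: (wlog_inj j i).
Qed.

(** The set X is a transversal of the y-orbits on R^#, chosen once for all
    functions g: fix_norm needs an element defined through X before the sum
    is known. *)
Lemma fpf_sum : exists2 X : {set gT}, X \subset R^# &
  forall (V : nmodType) (g : gT -> V),
  (\sum_(a in R^#) g a = \sum_(a in X) \sum_(i < p) g (a ^ (y ^+ i))%g)%R.
Proof.
have actsR : [acts <[y]>, on R^# | 'J].
  by rewrite astabsJ normD1 cycle_subG.
have [trX sXR injX _] := orbit_transversalP actsR.
set X := orbit_transversal _ _ _ in trX sXR injX.
exists X => // V g; rewrite (set_partition_big _ (orbit_partition actsR)) /=.
have -> : [set orbit 'J <[y]> x | x in R^#] = [set orbit 'J <[y]> x | x in X].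
  apply/eqP; rewrite eqEsubset [X in _ && X]imsetS // andbT.
  apply/subsetP=> _ /imsetP[x Rx ->].
  have [_ _ _ /(_ x Rx)[a ya Xa]] := orbit_transversalP actsR.
  apply/imsetP; exists ('J x a)%act => //.
  by apply/orbit_eqP; rewrite orbit_sym mem_orbit.
rewrite big_imset => [|a b Xa Xb /= eq_ab]; last first.
  by apply/eqP; rewrite -injX // eq_ab orbit_refl.
apply: eq_bigr => a Xa; have Ra := subsetP sXR a Xa.
have inj_a := fpf_orbit_inj Ra.
rewrite -(big_imset _ inj_a) /=; apply: eq_bigl => b.
apply/orbitP/imsetP => [[z /cycleP[n ->] <-{b}] | [i _ ->]]; last first.
  by exists (y ^+ i); rewrite ?mem_cycle.
exists (Ordinal (ltn_pmod n (prime_gt0 p_pr))) => //=.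
rewrite /= {1}(divn_eq n p) mulnC expgD expgM conjgM; congr (_ ^ _).
apply/conjg_fixP/commgP/commute_sym.
by apply: (centP (groupX _ cRyp)); case/setD1P: Ra.
Qed.

End FixedPointFree.

(** * Norms in abelian modules without fixed points *)

Section Norm.
Import FiniteModule GRing.Theory.
Local Open Scope ring_scope.

Variables (gT : finGroupType) (p : nat) (A R : {group gT}) (y : gT).
Hypotheses (p_pr : prime p) (nRy : y \in 'N(R)) (cRyp : (y ^+ p)%g \in 'C(R)).
Hypothesis regRy : ('C_R[y] = 1)%g.
Hypotheses (abA : abelian A) (nAR : R \subset 'N(A)) (nAy : y \in 'N(A)).
Hypothesis regAR : ('C_A(R) = 1)%g.

Let M := fmod_of abA.

(** The sum over the whole of R is fixed by R, hence zero; the term at 1 is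
    u. *)
Lemma fmod_sum_setD1 (u : M) : \sum_(a in R^#) u ^@ a = - u.
Proof.
apply/eqP; rewrite -addr_eq0 -[X in _ + X](actr1 u) addrC.
rewrite -[X in X == _](big_setD1 1%g (F := fun a => u ^@ a)) //=.
set s := \sum_(a in R) _; suffices: val s \in ('C_A(R))%g.
  by rewrite regAR => /set1P s1; apply/eqP; apply: fmod_inj.
rewrite inE fmodP; apply/centP=> b Rb; apply/commgP/conjg_fixP.
rewrite -fmvalJ ?(subsetP nAR) // actr_sum; congr val.
rewrite [s](reindex_inj (mulIg b)) /=; apply: eq_big => a.
  by rewrite groupMr.
by move=> Ra; rewrite actrM ?(subsetP nAR).
Qed.

Lemma fmod_sum_setD1V (u : M) : \sum_(a in R^#) u ^@ a^-1 = - u.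
Proof.
rewrite -fmod_sum_setD1 (reindex_inj invg_inj) /=; apply: eq_big => a.
  by rewrite !inE groupV invg_eq1.
by rewrite invgK.
Qed.

Lemma val_fmod_norm w : w \in A ->
  val (\sum_(i < p) fmod abA w ^@ (y ^+ i)) = (\prod_(i < p) w ^ (y ^+ i))%g.
Proof.
move=> Aw; rewrite -[LHS]/(fmval _) fmval_sum; apply: eq_bigr => i _.
by rewrite fmvalJ ?groupX // fmodK.
Qed.

Lemma fix_conj w n : (w ^ y = w -> w ^ (y ^+ n) = w)%g.
Proof. by move=> wy; apply/conjg_fixP/commgP/commuteX/commgP/conjg_fixP. Qed.

(** Conjugating the index by y amounts to letting y act, because w is fixed by
    y; this turns a sum over a y-orbit of R into a norm. *)
Lemma fix_actJ w a i : w \in A -> (w ^ y = w)%g -> a \in R ->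
  fmod abA w ^@ (a ^ (y ^+ i)) = fmod abA w ^@ a ^@ (y ^+ i).
Proof.
move=> Aw wy Ra; have Na := subsetP nAR a Ra.
have Ny : (y ^+ i)%g \in 'N(A)%g by rewrite groupX.
apply: val_inj; rewrite !fmvalJ ?groupJ // fmodK // -[in LHS](fix_conj i wy).
by rewrite -!conjgM -conjgC.
Qed.

(** Split - w, the sum of the w ^ a over R^#, along the y-orbits: it is the norm
    of the sum over a transversal. *)
Lemma fix_norm w : w \in A -> (w ^ y = w)%g ->
  exists2 z, z \in A & (\prod_(i < p) z ^ (y ^+ i) = w^-1)%g.
Proof.
move=> Aw wy; have [X sXR sumX] := fpf_sum p_pr nRy cRyp regRy.
pose z : M := \sum_(a in X) fmod abA w ^@ a.
exists (val z); first exact: fmodP.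
rewrite -val_fmod_norm ?fmodP // fmvalK.
suffices -> : \sum_(i < p) z ^@ (y ^+ i) = - fmod abA w by rewrite fmvalN fmodK.
rewrite -fmod_sum_setD1 sumX exchange_big /=.
apply: eq_bigr => i _; rewrite actr_sum; apply: eq_bigr => a Xa.
by rewrite fix_actJ //; have /setD1P[] := subsetP sXR a Xa.
Qed.

Lemma norm_neq0 (g : gT -> M) :
    (forall a i, a \in R -> g (a ^ (y ^+ i))%g = g a ^@ (y ^+ i)) ->
    \sum_(a in R^#) g a != 0 ->
  exists2 a, a \in R & \sum_(i < p) g a ^@ (y ^+ i) != 0.
Proof.
move=> gJ; have [X sXR sumX] := fpf_sum p_pr nRy cRyp regRy.
move=> nz_sum; apply/exists_inP; apply: contraR nz_sum => /exists_inPn all0.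
rewrite sumX big1 // => a Xa; have /setD1P[_ Ra] := subsetP sXR a Xa.
by rewrite (eq_bigr _ (fun (i : 'I_p) _ => gJ a i Ra)); apply/eqP/negPn/all0.
Qed.

Lemma norm_neq1 w : w \in A -> (w ^ y = w)%g -> (w != 1)%g ->
  exists2 a, a \in R & (\prod_(i < p) (w ^ a) ^ (y ^+ i) != 1)%g.
Proof.
move=> Aw wy nt_w; pose g a := fmod abA w ^@ a.
have [a i Ra||a Ra nz] := @norm_neq0 g; first exact: fix_actJ.
  by rewrite fmod_sum_setD1 oppr_eq0 -val_eqE /= fmodK.
have Na := subsetP nAR a Ra; exists a => //.
by rewrite -val_fmod_norm ?memJ_norm // fmodJ.
Qed.

(** Adding the term at a^-1 replaces the total - w by - 2 w, which is why w is
    required not to be an involution. *)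
Lemma symmetrized_norm_neq1 w : w \in A -> (w ^ y = w)%g -> (w ^+ 2 != 1)%g ->
  exists2 a, a \in R & (\prod_(i < p) (w ^ a * w ^ a^-1) ^ (y ^+ i) != 1)%g.
Proof.
move=> Aw wy nt_w; pose g a := fmod abA w ^@ a + fmod abA w ^@ a^-1%g.
have [a i Ra||a Ra nz] := @norm_neq0 g.
- by rewrite /g -conjVg !fix_actJ ?groupV // actAr.
- rewrite big_split /= fmod_sum_setD1V fmod_sum_setD1 -opprD oppr_eq0.
  by rewrite -val_eqE /= -[fmval _]/(fmval _ * fmval _)%g fmodK.
have [Na Nai] : a \in 'N(A)%g /\ a^-1%g \in 'N(A)%g.
  by rewrite groupV (subsetP nAR).
have [Awa Awi] : (w ^ a \in A)%g /\ (w ^ a^-1 \in A)%g by rewrite !memJ_norm.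
exists a => //; rewrite -val_fmod_norm ?(groupM Awa) //.
by rewrite fmodM // !fmodJ.
Qed.

End Norm.

(** * A class two section with coprime action *)

Section CoprimeAction.

Variables (gT : finGroupType) (p : nat).
Implicit Types D Q R : {group gT}.

(** R centralizes D / [D, R], so by coprime action D = C_D(R) [D, R]; here the
    second factor is contained in the first. *)
Lemma coprime_cents D R :
    p.-group D -> p^'.-group R -> R \subset 'N(D) -> [~: D, R] \subset 'C(R) ->
  R \subset 'C(D).
Proof.
move=> pD p'R nDR cDRR; have coDR := pnat_coprime pD p'R.
have sD1D : [~: D, R] \subset D by rewrite commg_subl.
have nD1R : R \subset 'N([~: D, R]) by rewrite commg_normr.
have := coprime_quotient_cent sD1D nD1R coDR (pgroup_sol pD).
have cD1 : D / [~: D, R] \subset 'C(R / [~: D, R]) by rewrite quotient_cents2r.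
rewrite (setIidPl cD1) => defD; rewrite centsC.
have: D / [~: D, R] \subset 'C_D(R) / [~: D, R] by rewrite defD.
by rewrite quotientSGK ?commg_norml ?subsetI ?sD1D // => /andP[].
Qed.

(** The hypotheses make D of class at most 2 and its R-fixed elements central.
    If g ^+ p is fixed by R, then [g, a] has order dividing p for a in R, hence
    is fixed by R and central, so that its order also divides that of a.  Thus
    g itself is fixed, and one climbs down the p-th powers of any element. *)
Lemma Ohm1_faithful D R : odd p ->
    p.-group D -> p^'.-group R -> R \subset 'N(D) ->
    [~: D, D] \subset 'C_D(R) -> 'C_D(R) \subset 'C(D) ->
  R \subset 'C('Ohm_1(D)) -> R \subset 'C(D).
Proof.
move=> p_odd pD p'R nDR sD'C sCZ cRO.
have cZ z u : z \in 'C_D(R) -> u \in D -> commute z u.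
  by move=> Cz Du; apply: (centP (subsetP sCZ z Cz)).
have step g : g \in D -> g ^+ p \in 'C(R) -> g \in 'C(R).
  move=> Dg Cgp; apply/centP=> a Ra; apply/commgP.
  have Dk : [~ g, a] \in D by rewrite groupM ?groupV ?memJ_norm ?(subsetP nDR).
  have gJ : g ^ a = g * [~ g, a] by rewrite mulKVg.
  have Cgk : [~ [~ g, a], g] \in 'C_D(R).
    by apply: (subsetP sD'C); rewrite mem_commg.
  have kp : [~ g, a] ^+ p = 1.
    have := conjXg g a p; rewrite gJ expMg_Rmul; last 2 first.
    - exact/commute_sym/cZ.
    - exact/commute_sym/cZ.
    have -> : g ^+ p ^ a = g ^+ p.
      by apply/conjg_fixP/commgP; apply: (centP Cgp).
    rewrite -[LHS]mulg1 -mulgA => /mulgI/esym.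
    (* As p is odd, it divides 'C(p, 2). *)
    suffices -> : [~ [~ g, a], g] ^+ 'C(p, 2) = 1 by rewrite mulg1.
    have cgk : [~ [~ g, a], g ^+ p] = 1.
      by apply/eqP/commgP/commute_sym/cZ => //; rewrite inE groupX.
    rewrite commgX in cgk; last exact/commute_sym/cZ.
    by rewrite bin2odd // expgM cgk expg1n.
  have Ck : [~ g, a] \in 'C_D(R).
    rewrite inE Dk; rewrite centsC in cRO; apply: (subsetP cRO).
    by rewrite (OhmE 1 pD) mem_gen // !inE Dk kp eqxx.
  have gJn n : g ^ (a ^+ n) = g * [~ g, a] ^+ n.
    elim: n => [|n IHn]; first by rewrite conjg1 mulg1.
    rewrite expgSr conjgM IHn conjMg gJ expgS -mulgA; congr (_ * (_ * _)).
    by apply/conjg_fixP/commgP; case/setIP: Ck => _ /(groupX n)/centP; apply.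
  have := gJn #[a]; rewrite expg_order conjg1 -{1}[g]mulg1 => /mulgI/esym ka1.
  suffices: #[[~ g, a]] == 1%N by rewrite order_eq1.
  rewrite -dvdn1 -(eqP (pnat_coprime (mem_p_elt pD Dk) (mem_p_elt p'R Ra))).
  by rewrite dvdn_gcd dvdnn order_dvdn ka1 /=.
rewrite centsC; apply/subsetP=> g Dg.
have [n def_g] := p_natP (mem_p_elt pD Dg).
suffices: forall m, g ^+ (p ^ m) \in 'C(R) -> g \in 'C(R).
  by move/(_ n); apply; rewrite -def_g expg_order group1.
elim=> [|m IHm]; first by rewrite expg1.
by rewrite expnSr expgM => /(step _ (groupX _ Dg)).
Qed.

(** Let D be the last term of the lower central series of Q on which R acts
    nontrivially, and D1 = [D, R].  As R centralizes [D, Q], the three subgroup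
    lemma shows that D1 is centralized by C_D(R) and by y ^+ p.  For p odd one
    passes to the elements of order p of D1, which form a group of exponent p
    since D1 has class at most 2. *)
Lemma class2_coprime_section Q R y :
    prime p -> p.-group Q -> p^'.-group R -> R \subset 'N(Q) -> y \in 'N(Q) ->
    y \in 'N(R) -> y ^+ p \in 'C(R) ->
    (exists2 t, t \in Q & {in Q, forall u, u ^ (y ^+ p) = u ^ t}) ->
    ~~ (R \subset 'C(Q)) ->
  exists E : {group gT},
    [/\ [/\ E \subset Q, R \subset 'N(E), y \in 'N(E) & y ^+ p \in 'C(E)],
        [~: E, E] \subset 'C(R), 'C_E(R) \subset 'C(E), ~~ (R \subset 'C(E))
      & odd p -> exponent E %| p].
Proof.
move=> p_pr pQ p'R nQR nQy nRy cRyp [t Qt actt] ntQR.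
have [n ncn cn1] : exists2 n,
  ~~ (R \subset 'C('L_n.+1(Q))) & R \subset 'C('L_n.+2(Q)).
  have exn : exists n, R \subset 'C('L_n.+1(Q)).
    by have /lcnP[n LQ1] := pgroup_nil pQ; exists n; rewrite LQ1 cents1.
  case: (ex_minnP exn) => [[|n]] cn minn.
    by rewrite lcn1 (negPf ntQR) in cn.
  by exists n => //; apply/negP=> /minn; rewrite ltnn.
pose D := 'L_n.+1(Q)%G; rewrite lcnSn -/D in cn1.
have [chD sDQ] : D \char Q /\ D \subset Q by rewrite lcn_char lcn_sub.
have pD : p.-group D := pgroupS sDQ pQ.
have nDR : R \subset 'N(D) := char_norm_trans chD nQR.
have nDy : y \in 'N(D) by rewrite -cycle_subG (char_norm_trans chD) ?cycle_subG.
pose D1 := [~: D, R]%G.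
have sD1D : D1 \subset D by rewrite commg_subl.
have nD1R : R \subset 'N(D1) by rewrite commg_normr.
have nD1y : y \in 'N(D1) by rewrite -cycle_subG normsR ?cycle_subG.
have ntD1R : ~~ (R \subset 'C(D1)).
  by apply: contra ncn => cD1; apply: coprime_cents => //; rewrite centsC.
have cD1C : 'C_D(R) \subset 'C(D1).
  rewrite centsC; apply/commG1P/three_subgroup.
    have ->: [~: R, 'C_D(R)] = 1 by apply/commG1P; rewrite centsC subsetIr.
    by rewrite comm1G.
  apply/commG1P; rewrite centsC (subset_trans cn1) ?centS //.
  by rewrite (commGC 'C_D(R)) commgS // subIset ?sDQ.
have cD1yp : y ^+ p \in 'C(D1).
  rewrite -cycle_subG centsC; apply/commG1P/three_subgroup.
    have ->: [~: R, <[y ^+ p]>] = 1.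
      by apply/commG1P; rewrite centsC cycle_subG.
    by rewrite comm1G.
  apply/commG1P; rewrite centsC (subset_trans cn1) ?centS //.
  have nKQ : Q \subset 'N([~: D, Q]) by rewrite commg_normr.
  have nKyp : y ^+ p \in 'N([~: D, Q]).
    by apply: groupX; rewrite -cycle_subG normsR ?cycle_subG.
  rewrite -quotient_cents2 ?cycle_subG ?(subset_trans sDQ) //.
  rewrite quotient_cycle // cycle_subG; apply/centP=> _ /morphimP[d Nd Dd ->].
  rewrite /commute -!morphM // [in RHS]conjgC actt ?(subsetP sDQ) //.
  have Kdt : [~ d, t] \in [~: D, Q] by rewrite mem_commg.
  have ->: d ^ t = d * [~ d, t] by rewrite mulKVg.
  have Nkdt : [~ d, t] \in 'N([~: D, Q]) := subsetP (normG _) _ Kdt.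
  by rewrite mulgA [RHS]morphM ?(groupM nKyp) //= (coset_id Kdt) mulg1.
have sD1' : [~: D1, D1] \subset 'C_D(R).
  rewrite subsetI (subset_trans (commgSS sD1D sD1D)) ?der1_subG //.
  rewrite (subset_trans (commgSS sD1D (subset_trans sD1D sDQ))) //.
  by rewrite centsC.
pose E := if odd p then 'Ohm_1(D1)%G else D1.
have chE : E \char D1 by rewrite /E; case: ifP; rewrite ?char_refl ?Ohm_char.
have sED1 := char_sub chE; have sED := subset_trans sED1 sD1D.
have pD1 := pgroupS sD1D pD.
have sD1Z : [~: D1, D1] \subset 'C(D1) := subset_trans sD1' cD1C.
exists E; split; first split.
- exact: subset_trans sED sDQ.
- exact: char_norm_trans chE nD1R.
- by rewrite -cycle_subG (char_norm_trans chE) ?cycle_subG.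
- by apply: subsetP cD1yp; rewrite centS.
- rewrite (subset_trans (commgSS sED1 sED1)) //.
  by rewrite (subset_trans sD1') ?subsetIr.
- rewrite (subset_trans _ (centS sED1)) // (subset_trans _ cD1C) //.
  by rewrite setSI.
- rewrite /E; case: ifP => // p_odd; apply: contra ntD1R.
  apply: Ohm1_faithful => //.
    by rewrite subsetI der1_subG (subset_trans sD1') ?subsetIr.
  by rewrite (subset_trans _ cD1C) ?setSI.
- move=> p_odd; rewrite /E p_odd; apply: exponent_Ohm1_class2 => //.
  by rewrite nil_class2 subsetI der_sub.
Qed.

End CoprimeAction.

(** * Vectors whose norm is not fixed *)

Section FreeVector.

Variables (gT : finGroupType) (p : nat) (E R : {group gT}) (y : gT).
Hypotheses (p_pr : prime p) (pE : p.-group E).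
Hypotheses (p'R : p^'.-group R) (abR : abelian R).
Hypotheses (py : p.-elt y) (nER : R \subset 'N(E)) (nEy : y \in 'N(E)).
Hypotheses (nRy : y \in 'N(R)) (cRyp : y ^+ p \in 'C(R)) (regRy : 'C_R[y] = 1).
Hypotheses (E'C : [~: E, E] \subset 'C(R)) (sCZ : 'C_E(R) \subset 'C(E)).
Hypothesis ntER : ~~ (R \subset 'C(E)).

Let Z := 'C_E(R)%G.

Let cZE z u : z \in Z -> u \in E -> commute z u.
Proof. by move=> Zz Eu; apply: (centP (subsetP sCZ z Zz)). Qed.

Let commZ u w : u \in E -> w \in E -> [~ u, w] \in Z.
Proof.
move=> Eu Ew; rewrite inE groupR //=; apply: (subsetP E'C).
by rewrite mem_commg.
Qed.

Let commJ u w a : a \in R -> u \in E -> w \in E -> [~ u ^ a, w ^ a] = [~ u, w].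
Proof.
move=> Ra Eu Ew; rewrite -conjRg; apply/conjg_fixP/commgP.
by have /setIP[_ /centP] := commZ Eu Ew; apply.
Qed.

Let commM u1 u2 w : u1 \in E -> u2 \in E -> w \in E ->
  [~ u1 * u2, w] = [~ u1, w] * [~ u2, w].
Proof.
move=> Eu1 Eu2 Ew; rewrite commMgJ; congr (_ * _).
by apply/conjg_fixP/commgP/cZE => //; apply: commZ.
Qed.

Let commMr u w1 w2 : u \in E -> w1 \in E -> w2 \in E ->
  [~ u, w1 * w2] = [~ u, w1] * [~ u, w2].
Proof.
move=> Eu Ew1 Ew2; rewrite -invg_comm commM // invMg !invg_comm.
by apply: cZE; rewrite ?commZ ?groupR.
Qed.

(** Modulo C_E(R), y fixes w and acts on w ^ c through c alone; the commutator
    map of E is bilinear, R-invariant and blind to C_E(R).  With b = a ^ y ^+ n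
    and f c = [w, w ^ c], the commutator to be killed is the product of the f c
    for c = b a^-1, b^-1 a^-1, b a and b^-1 a, and these cancel in pairs because
    f c^-1 = (f c)^-1 and R is abelian. *)
Lemma symmetrized_commute w a n : w \in E -> a \in R -> [~ w, y ^+ n] \in Z ->
  commute (w ^ a * w ^ a^-1) ((w ^ a * w ^ a^-1) ^ (y ^+ n)).
Proof.
move=> Ew Ra Zwy; set b := a ^ (y ^+ n).
have Rb : b \in R by rewrite memJ_norm ?groupX.
have EJ c : c \in R -> w ^ c \in E.
  by move=> Rc; rewrite memJ_norm ?(subsetP nER).
have wyJ c : c \in R -> (w ^ c) ^ (y ^+ n) = w ^ (c ^ (y ^+ n)) * [~ w, y ^+ n].
  move=> Rc; have Rcy : c ^ (y ^+ n) \in R by rewrite memJ_norm ?groupX.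
  have -> : (w ^ c) ^ (y ^+ n) = (w ^ (y ^+ n)) ^ (c ^ (y ^+ n)).
    by rewrite -!conjgM -conjgC.
  rewrite -{1}[w ^ y ^+ n](mulKVg w) conjMg; congr (_ * _).
  by apply/conjg_fixP/commgP; have /setIP[_ /centP] := Zwy; apply.
have -> : (w ^ a * w ^ a^-1) ^ y ^+ n = w ^ b * w ^ b^-1 * [~ w, y ^+ n] ^+ 2.
  have /= cz := cZE Zwy (EJ b^-1 (groupVr Rb)).
  rewrite conjMg !wyJ ?groupV // conjVg -/b; move: [~ w, _] cz => z cz.
  by rewrite -2!mulgA (mulgA z) cz -!mulgA.
(* Keeps later rewriting from seeing b as a conjugate. *)
clearbody b; have Ev c : c \in R -> w ^ c * w ^ c^-1 \in E.
  by move=> Rc; rewrite groupM ?EJ ?groupV.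
apply: commuteM; last by apply/commuteX/commute_sym/cZE/Ev.
have [Ea Ea'] := (EJ a Ra, EJ _ (groupVr Ra)).
have [Eb Eb'] := (EJ b Rb, EJ _ (groupVr Rb)).
apply/commgP; rewrite (commM Ea Ea') ?(groupM Eb Eb') //.
rewrite (commMr Ea) // (commMr Ea') //.
pose f c := [~ w, w ^ c].
have fE c d : c \in R -> d \in R -> [~ w ^ c, w ^ d] = f (d * c^-1).
  move=> Rc Rd; rewrite -(@commJ _ _ c^-1) ?groupV ?EJ //.
  by rewrite conjgK -conjgM.
have fV c : c \in R -> f c^-1 = (f c)^-1.
  by move=> Rc; rewrite /f invg_comm -(commJ Rc) ?EJ ?groupV // conjgKV.
have cR c d : c \in R -> d \in R -> c * d = d * c.
  by move=> Rc; apply: (centsP abR).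
rewrite !fE ?groupV // invgK.
have -> : b^-1 * a = (b * a^-1)^-1 by rewrite invMg invgK cR ?groupV.
have -> : b^-1 * a^-1 = (b * a)^-1 by rewrite invMg cR ?groupV.
by rewrite !fV ?(groupM, groupV) // -mulgA mulKg mulgV.
Qed.

Let nZy : y \in 'N(Z).
Proof.
by rewrite -cycle_subG normsI ?norms_cent ?cycle_subG.
Qed.

Let nZR : R \subset 'N(Z).
Proof. by rewrite cents_norm // centsC subsetIr. Qed.

Let nZE : E \subset 'N(Z).
Proof. by rewrite cents_norm // centsC. Qed.

(** The nontrivial normal subgroup E / C_E(R) of the p-group E <y> / C_E(R)
    contains a central element of order p. *)
Lemma fixed_coset : exists2 w, w \in E &
  [/\ w \notin Z, w ^+ p \in Z & [~ w, y] \in Z].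
Proof.
pose W := (E <*> <[y]>)%G.
have nEY : <[y]> \subset 'N(E) by rewrite cycle_subG.
have pW : p.-group W by rewrite /= norm_joinEr // pgroupM pE.
have nZW : W \subset 'N(Z) by rewrite join_subG nZE cycle_subG.
have nsEW : E / Z <| W / Z.
  by rewrite quotient_normal // /normal joing_subl join_subG normG.
have ntE : E / Z != 1.
  apply: contra ntER => /eqP/trivgP; rewrite quotient_sub1 // => sEZ.
  by rewrite centsC (subset_trans sEZ) ?subsetIr.
have pWZ := quotient_pgroup Z pW.
have ntZ := meet_center_nil (pgroup_nil pWZ) nsEW ntE.
have pEZ := pgroupS (subsetIl _ 'Z(W / Z)) (pgroupS (normal_sub nsEW) pWZ).
have [_ p_dv _] := pgroup_pdiv pEZ ntZ.
have [_ /setIP[/morphimP[w Nw Ew ->]] /centerP[_ cW] oX] := Cauchy p_pr p_dv.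
exists w => //; split.
- by apply: contraL p_pr => Zw; rewrite -oX /= (coset_id Zw) order1.
- by rewrite coset_idr ?groupX // morphX //= -oX expg_order.
have Wy : coset Z y \in W / Z.
  by rewrite mem_quotient // mem_gen // inE cycle_id orbT.
by rewrite coset_idr ?groupR // morphR //; apply/eqP/commgP/cW/Wy.
Qed.

(* The hypotheses of the norm lemmas, for R and y acting on E / Z. *)
Let abEZ : abelian (E / Z).
Proof. by rewrite sub_der1_abelian // subsetI der1_subG. Qed.

Let regEZ : 'C_(E / Z)(R / Z) = 1.
Proof.
rewrite -coprime_quotient_cent ?subsetIl ?(pnat_coprime pE) ?(pgroup_sol pE) //.
by rewrite -/Z trivg_quotient.
Qed.

Let regRZ : 'C_(R / Z)[coset Z y] = 1.
Proof.
apply/trivgP/subsetP=> _ /setIP[/morphimP[a Na Ra ->] /cent1P cay].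
have: [~ a, y] \in Z :&: R.
  apply/setIP; split; last by rewrite groupM ?groupV // memJ_norm.
  by rewrite coset_idr ?groupR // morphR //; apply/eqP/commgP.
have coZR : coprime #|Z| #|R|.
  exact: coprimeSg (subsetIl _ _) (pnat_coprime pE p'R).
rewrite (coprime_TIg coZR) => /set1P/eqP/commgP cay'.
have: a \in 'C_R[y] by rewrite inE Ra; apply/cent1P.
by rewrite regRy => /set1P ->; rewrite morph1 inE.
Qed.

Let norm_coset v : v \in E ->
  \prod_(i < p) coset Z v ^ (coset Z y ^+ i) =
    coset Z (\prod_(i < p) v ^ (y ^+ i)).
Proof.
move=> Ev; have Nv := subsetP nZE v Ev.
rewrite morph_prod => [|i _]; last by rewrite groupJ ?groupX.
by apply: eq_bigr => i _; rewrite morphJ ?morphX ?groupX.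
Qed.

Let norm_notin v : v \in E ->
    \prod_(i < p) coset Z v ^ (coset Z y ^+ i) != 1 ->
  \prod_(i < p) v ^ (y ^+ i) \notin 'C(R).
Proof.
move=> Ev; rewrite norm_coset //; apply: contra => cR.
rewrite coset_id // inE cR andbT group_prod // => i _.
by rewrite memJ_norm ?groupX.
Qed.

Let nRZy : coset Z y \in 'N(R / Z).
Proof.
by rewrite -cycle_subG -quotient_cycle ?quotient_norms ?cycle_subG.
Qed.

Let cRZyp : coset Z y ^+ p \in 'C(R / Z).
Proof.
rewrite -morphX // -cycle_subG -quotient_cycle ?groupX //.
by rewrite quotient_cents ?cycle_subG.
Qed.

Let nEZy : coset Z y \in 'N(E / Z).
Proof.
by rewrite -cycle_subG -quotient_cycle ?quotient_norms ?cycle_subG.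
Qed.

Lemma free_vector : exists2 v, v \in E &
  v ^+ p \in 'C(R) /\ \prod_(i < p) v ^ (y ^+ i) \notin 'C(R).
Proof.
have [w Ew [ntw wp wy]] := fixed_coset; have Nw := subsetP nZE w Ew.
have ywZ : coset Z w ^ coset Z y = coset Z w.
  by apply/conjg_fixP; rewrite -morphR //= coset_id.
have wZ1 : coset Z w != 1.
  by apply: contra ntw => /eqP/coset_idr->.
have [_ /morphimP[a Na Ra ->] nt] := norm_neq1 p_pr nRZy cRZyp regRZ abEZ
  (quotient_norms _ nER) nEZy regEZ (mem_quotient Z Ew) ywZ wZ1.
have Ea : w ^ a \in E by rewrite memJ_norm ?(subsetP nER).
exists (w ^ a) => //; split; last by apply: norm_notin; rewrite ?morphJ.
have /setIP[_ cwp] := wp; rewrite -conjXg (conjg_fixP _) //.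
by apply/commgP; apply: (centP cwp).
Qed.

Lemma free_commuting_vector : odd p -> exponent E %| p -> exists2 v, v \in E &
  [/\ v ^+ p = 1, forall n, commute v (v ^ (y ^+ n))
    & \prod_(i < p) v ^ (y ^+ i) \notin 'C(R)].
Proof.
move=> p_odd expE.
have [w Ew [ntw wp wy]] := fixed_coset; have Nw := subsetP nZE w Ew.
have ywZ : coset Z w ^ coset Z y = coset Z w.
  by apply/conjg_fixP; rewrite -morphR //= coset_id.
have wZ2 : coset Z w ^+ 2 != 1.
  rewrite -morphX //; apply: contra ntw => /eqP/coset_idr Zw2.
  apply: (@mem_exp_coprime _ Z w 2 p) => //; first by rewrite coprime2n.
  by rewrite Zw2 ?groupX.
have [_ /morphimP[a Na Ra ->] nt] :=
  symmetrized_norm_neq1 p_pr nRZy cRZyp regRZ abEZ (quotient_norms _ nER)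
    nEZy regEZ (mem_quotient Z Ew) ywZ wZ2.
have Ea c : c \in R -> w ^ c \in E.
  by move=> Rc; rewrite memJ_norm ?(subsetP nER).
have Na' : a^-1 \in 'N(Z) by rewrite groupV.
have [Ea1 Ea2] := (Ea a Ra, Ea _ (groupVr Ra)).
have [Nw1 Nw2] := (subsetP nZE _ Ea1, subsetP nZE _ Ea2).
exists (w ^ a * w ^ a^-1); first by rewrite (groupM Ea1).
split.
- by apply: (exponentP expE); rewrite (groupM Ea1).
- move=> n; apply: symmetrized_commute => //.
  rewrite coset_idr ?groupR ?groupX // morphR ?groupX //= morphX //.
  by apply/eqP/commgP/commuteX/commgP/conjg_fixP.
by apply: norm_notin; rewrite ?(groupM Ea1) // morphM // !morphJ // morphV.
Qed.

End FreeVector.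

(** * Lifting a coprime action to a p-group *)

Lemma expMg_norm (gT : finGroupType) (A : {group gT}) (y z : gT) n :
    abelian A -> y \in 'N(A) -> z \in A ->
  (y * z) ^+ n = y ^+ n * \prod_(i < n) z ^ (y ^+ i).
Proof.
move=> abA nAy Az; have Azy i : z ^ (y ^+ i) \in A by rewrite memJ_norm ?groupX.
elim: n => [|n IHn]; first by rewrite big_ord0 mulg1.
rewrite big_ord_recr /= expgS IHn expgS.
have Apr : \prod_(i < n) z ^ (y ^+ i) \in A by apply: group_prod.
have def_zy : z * y ^+ n = y ^+ n * z ^ (y ^+ n) by rewrite -conjgC.
move: (Azy n) def_zy Apr; move: (z ^ _) (\prod_(i < n) _) => u v Au def_zy Av.
by rewrite -!mulgA (mulgA z) def_zy -!mulgA (centsP abA u Au v Av).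
Qed.

(** As y ^+ p commutes with R and acts on Q as t does, R centralizes t modulo
    Z(Q).  By coprime action t = c * w with c fixed by R and w in
    [<t> Z(Q), R], a subgroup of Z(Q) on which R has no nontrivial fixed point;
    this decomposition is unique, so y fixes w, and w^-1 is a norm. *)
Lemma centralize_power (gT : finGroupType) (p : nat) (Q R : {group gT}) y t :
    prime p -> p.-group Q -> p^'.-group R -> R \subset 'N(Q) -> y \in 'N(Q) ->
    y \in 'N(R) -> y ^+ p \in 'C(R) -> 'C_R[y] = 1 ->
    t \in Q -> t ^ y = t -> {in Q, forall u, u ^ (y ^+ p) = u ^ t} ->
  exists2 z, z \in 'Z(Q) & t * \prod_(i < p) z ^ (y ^+ i) \in 'C(R).
Proof.
move=> p_pr pQ p'R nQR nQy nRy cRyp regRy Qt ty actt.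
pose B := ('Z(Q) <*> <[t]>)%G.
have sZQ : 'Z(Q) \subset Q := center_sub Q.
have nZR : R \subset 'N('Z(Q)) := char_norm_trans (center_char Q) nQR.
have nZy : y \in 'N('Z(Q)).
  by rewrite -cycle_subG (char_norm_trans (center_char Q)) ?cycle_subG.
have cZt : <[t]> \subset 'C('Z(Q)).
  by rewrite centsC subIset // centS ?orbT ?cycle_subG.
have abB : abelian B.
  by rewrite abelianY center_abelian cycle_abelian cZt.
have sBQ : B \subset Q by rewrite join_subG sZQ cycle_subG.
have tR a : a \in R -> [~ t, a] \in 'Z(Q).
  move=> Ra; have Qta : t ^ a \in Q by rewrite memJ_norm ?(subsetP nQR).
  apply/centerP; split; first by rewrite groupM ?groupV.
  move=> u Qu; apply/commute_sym/commgP/conjg_fixP.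
  have act_ta x : x \in Q -> x ^ (t ^ a) = x ^ t.
    move=> Qx; have Qxa : x ^ a^-1 \in Q.
      by rewrite memJ_norm ?groupV ?(subsetP nQR).
    rewrite [t ^ a]conjgE 2!conjgM -actt // -!conjgM.
    by rewrite (centP cRyp) // mulKg actt.
  by rewrite conjgM act_ta ?conjgKV // memJ_norm ?groupV // (subsetP (normG Q)).
have sBRZ : [~: B, R] \subset 'Z(Q).
  rewrite -quotient_cents2 // ?(subset_trans sBQ) ?char_norm ?center_char //.
  have Nt : t \in 'N('Z(Q)) by rewrite (subsetP (cents_norm cZt)) ?cycle_id.
  rewrite quotientYidl ?cycle_subG // quotient_cycle // cycle_subG.
  apply/centP=> _ /morphimP[a Na Ra ->].
  by apply/commgP; rewrite -morphR //= coset_id ?tR.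
have nBR : R \subset 'N(B).
  by rewrite -commg_subl (subset_trans sBRZ) ?joing_subl.
have nBy : y \in 'N(B).
  rewrite -cycle_subG normsY ?cycle_subG //.
  apply: (subsetP (cent_sub _)); rewrite cent_cycle.
  by apply/cent1P/commute_sym/commgP/conjg_fixP.
have pB := pgroupS sBQ pQ; have coBR := pnat_coprime pB p'R.
pose W := [~: B, R]%G.
have sWB : W \subset B by rewrite commg_subl.
have nWR : R \subset 'N(W) by rewrite commg_normr.
have nWy : y \in 'N(W) by rewrite -cycle_subG normsR ?cycle_subG.
have tiW : 'C_W(R) = 1 by apply: coprime_abel_cent_TI.
have [c Cc [w Ww def_t]] :
  exists2 c, c \in 'C_B(R) & exists2 w, w \in W & t = c * w.
  have defB := coprime_quotient_cent sWB nWR coBR (pgroup_sol pB).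
  have cBR : B / W \subset 'C(R / W) by rewrite quotient_cents2r.
  rewrite (setIidPl cBR) in defB.
  have Bt : t \in B by rewrite mem_gen // inE cycle_id orbT.
  have nWB : B \subset 'N(W) by rewrite commg_norml.
  have: t \in 'C_B(R) * W.
    rewrite normC ?subIset ?nWB //.
    rewrite -quotientK ?subIset ?nWB // defB quotientK //.
    by rewrite mulSGid.
  by case/mulsgP=> c w Cc Ww ->; exists c => //; exists w.
have Cyc : c ^ y \in 'C_B(R).
  by rewrite memJ_norm // -cycle_subG normsI ?norms_cent ?cycle_subG.
have Wwy : w ^ y \in W by rewrite memJ_norm.
have wy : w ^ y = w.
  have eq_cw : c^-1 * c ^ y = w * (w ^ y)^-1.
    apply: (mulgI c); apply: (mulIg (w ^ y)).
    by rewrite mulKVg -conjMg -def_t ty -mulgA mulgKV.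
  have: w * (w ^ y)^-1 \in 'C_W(R).
    apply/setIP; split; first by rewrite groupM ?groupV.
    rewrite -eq_cw; have [/setIP[_ cRc] /setIP[_ cRcy]] := (Cc, Cyc).
    by rewrite groupM ?groupV.
  by rewrite tiW => /set1P/(canRL (mulgKV _)); rewrite mul1g.
have abW := abelianS sWB abB.
have [z Wz Nz] := fix_norm p_pr nRy cRyp regRy abW nWR nWy tiW Ww wy.
exists z; first by rewrite (subsetP sBRZ).
by rewrite Nz def_t mulgK; case/setIP: Cc.
Qed.

(** What the coprime action leaves behind inside the p-group: C stands for the
    elements fixed by the p'-group and E for the class two section.  The
    p'-group itself is gone, as it does not act on the whole p-group. *)
Record free_orbit (gT : finGroupType) (p : nat) (C E : {group gT}) (x v : gT) :
    Prop := FreeOrbit {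
  orbit_normC : x \in 'N(C);
  orbit_normE : x \in 'N(E);
  orbit_expC : x ^+ p \in C;
  orbit_exp_cent : x ^+ p \in 'C(E);
  orbit_der1 : [~: E, E] \subset C;
  orbit_cent : E :&: C \subset 'C(E);
  orbit_mem : v \in E;
  orbit_vecX : v ^+ p \in C;
  orbit_norm : \prod_(i < p) v ^ (x ^+ i) \notin C;
  orbit_odd : odd p -> v ^+ p = 1 /\ forall n, commute v (v ^ (x ^+ n))
}.

(** The p'-group R and the p-element h live in an overgroup of a copy i(Q) of Q,
    where h is only required to act on Q as y does; y and R need not belong to
    a common group. *)
Section Transfer.

Variables (gT sT : finGroupType) (p : nat) (Q : {group gT}) (y : gT).
Variables (i : {morphism Q >-> sT}) (R : {group sT}) (h : sT).
Hypotheses (p_pr : prime p) (pQ : p.-group Q).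
Hypotheses (nQy : y \in 'N(Q)) (Qyp : y ^+ p \in Q).
Hypotheses (inji : 'injm i) (iJ : {in Q, forall u, i (u ^ y) = i u ^ h}).
Hypotheses (p'R : p^'.-group R) (abR : abelian R) (nQR : R \subset 'N(i @* Q)).
Hypotheses (ph : p.-elt h) (nRh : h \in 'N(R)) (cRhp : h ^+ p \in 'C(R)).
Hypotheses (regRh : 'C_R[h] = 1) (ntR : ~~ (R \subset 'C(i @* Q))).

Let iJX x n : x \in 'N(Q) -> {in Q, forall u, i (u ^ x) = i u ^ h} ->
  {in Q, forall u, i (u ^ (x ^+ n)) = i u ^ (h ^+ n)}.
Proof.
move=> nQx iJx u Qu; elim: n => [|n IHn]; first by rewrite !conjg1.
by rewrite !expgSr !conjgM iJx ?IHn // memJ_norm ?groupX.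
Qed.

Let nQh : h \in 'N(i @* Q).
Proof.
rewrite inE; apply/subsetP=> _ /imsetP[_ /morphimP[u _ Qu ->] ->].
by rewrite -iJ // mem_morphim ?memJ_norm.
Qed.

(** Since x differs from y by a central element of Q, it acts on Q as h does;
    C and E are the preimages of the centralizer of R and of the section found
    in i(Q). *)
Lemma lift_configuration :
  exists2 x, x \in y *: 'Z(Q) & exists (C E : {group gT}) (v : gT),
    [/\ C \subset Q, E \subset Q & free_orbit p C E x v].
Proof.
have actt : {in i @* Q, forall u, u ^ (h ^+ p) = u ^ i (y ^+ p)}.
  by move=> _ /morphimP[u _ Qu ->]; rewrite -(iJX _ nQy iJ) // morphJ.
have tK : i (y ^+ p) ^ h = i (y ^+ p).
  by rewrite -iJ //; congr (i _); apply/conjg_fixP/commgP/commute_sym/commuteX.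
have pQ' : p.-group (i @* Q) by rewrite morphim_pgroup.
have [_ /morphimP[z Qz' Zz ->] cRt] : exists2 z, z \in i @* 'Z(Q) &
    i (y ^+ p) * \prod_(j < p) z ^ (h ^+ j) \in 'C(R).
  have [z Zz cRz] := centralize_power p_pr pQ' p'R nQR nQh nRh cRhp
    regRh (mem_morphim i Qyp Qyp) tK actt.
  by exists z => //; rewrite injm_center.
have nZy : y \in 'N('Z(Q)).
  by rewrite -cycle_subG (char_norm_trans (center_char Q)) ?cycle_subG.
exists (y * z); first by rewrite mem_lcoset mulKg.
set x := y * z; have nQx : x \in 'N(Q) by rewrite groupM // (subsetP (normG Q)).
have xpE : x ^+ p = y ^+ p * \prod_(j < p) z ^ (y ^+ j).
  by rewrite (expMg_norm p (center_abelian Q)).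
have Qzy j : z ^ (y ^+ j) \in Q by rewrite memJ_norm ?groupX.
have Qxp : x ^+ p \in Q by rewrite xpE groupM // group_prod.
have cRxp : i (x ^+ p) \in 'C(R).
  rewrite xpE morphM ?group_prod // morph_prod //.
  by rewrite (eq_bigr _ (fun (j : 'I_p) _ => iJX j nQy iJ Qz')).
have ixJ : {in Q, forall u, i (u ^ x) = i u ^ h}.
  move=> u Qu; have Quy : u ^ y \in Q by rewrite memJ_norm.
  rewrite conjgM -iJ //; congr (i _); apply/conjg_fixP/commgP.
  by have /centerP[_ cz] := Zz; apply/commute_sym/cz.
have [E' [[sE'Q nE'R nE'h cE'hp] E'C cEC ntE' expE]] :=
  class2_coprime_section p_pr pQ' p'R nQR nQh nRh cRhp
    (ex_intro2 _ _ (i (y ^+ p)) (mem_morphim i Qyp Qyp) actt) ntR.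
pose C := (i @*^-1 'C(R))%G; pose E := (i @*^-1 E')%G.
have sCQ : C \subset Q by apply: subsetIl.
have sEQ : E \subset Q by apply: subsetIl.
have memE u : u \in Q -> (u \in E) = (i u \in E').
  by move=> Qu; rewrite !inE Qu.
have memC u : u \in Q -> (u \in C) = (i u \in 'C(R)).
  by move=> Qu; rewrite !inE Qu.
have nCx : x \in 'N(C).
  rewrite inE; apply/subsetP=> _ /imsetP[u Cu ->]; have Qu := subsetP sCQ u Cu.
  rewrite memC ?memJ_norm // ixJ // memJ_norm -?memC //.
  by rewrite (subsetP (cent_norm R)).
have nEx : x \in 'N(E).
  rewrite inE; apply/subsetP=> _ /imsetP[u Eu ->]; have Qu := subsetP sEQ u Eu.
  by rewrite memE ?memJ_norm // ixJ // memJ_norm -?memE.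
have injC u w : u \in Q -> w \in Q -> commute (i u) (i w) -> commute u w.
  move=> Qu Qw cuw; apply: (injmP inji); rewrite ?groupM //.
  by rewrite !morphM.
have norm_v v : v \in Q ->
    i (\prod_(j < p) v ^ (x ^+ j)) = \prod_(j < p) i v ^ (h ^+ j).
  move=> Qv; rewrite morph_prod => [|j _]; last by rewrite memJ_norm ?groupX.
  by apply: eq_bigr => j _; rewrite (iJX _ nQx ixJ).
have Qprod v : v \in Q -> \prod_(j < p) v ^ (x ^+ j) \in Q.
  by move=> Qv; rewrite group_prod // => j _; rewrite memJ_norm ?groupX.
have cxp : x ^+ p \in 'C(E).
  apply/centP=> u Eu; have Qu := subsetP sEQ u Eu.
  apply/commute_sym/commgP/conjg_fixP.
  apply: (injmP inji); rewrite ?memJ_norm ?groupX //.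
  rewrite (iJX _ nQx ixJ) //; apply/conjg_fixP/commgP/commute_sym.
  by apply: (centP cE'hp); rewrite -memE.
have sEEC : [~: E, E] \subset C.
  rewrite gen_subG; apply/subsetP=> _ /imset2P[u w Eu Ew ->].
  have [Qu Qw] := (subsetP sEQ u Eu, subsetP sEQ w Ew).
  rewrite memC ?groupR // morphR //; apply: (subsetP E'C).
  by rewrite mem_commg -?memE.
have sECE : E :&: C \subset 'C(E).
  apply/subsetP=> u /setIP[Eu Cu]; apply/centP=> w Ew.
  have [Qu Qw] := (subsetP sEQ u Eu, subsetP sEQ w Ew).
  apply: injC => //; apply: (centP (subsetP cEC _ _)); last by rewrite -memE.
  by rewrite inE -memE // -memC // Eu.
have pE' : p.-group E' := pgroupS sE'Q pQ'.
have [v Ev [vp nv v_odd]] : exists2 v, v \in E & [/\ v ^+ p \in C,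
    \prod_(j < p) v ^ (x ^+ j) \notin C
    & odd p -> v ^+ p = 1 /\ forall n, commute v (v ^ (x ^+ n))].
  have [p_odd | p_even] := boolP (odd p); last first.
    have [w E'w [wp nw]] :=
      free_vector p_pr pE' p'R ph nE'R nE'h nRh cRhp regRh E'C cEC ntE'.
    have /morphimP[v Qv _ def_w] := subsetP sE'Q w E'w.
    exists v; first by rewrite memE -?def_w.
    by rewrite !memC ?Qprod ?groupX // norm_v // morphX // -def_w.
  have [w E'w [wp cw nw]] :=
    free_commuting_vector p_pr pE' p'R abR ph nE'R nE'h nRh cRhp regRh
      E'C cEC ntE' p_odd (expE p_odd).
  have /morphimP[v Qv _ def_w] := subsetP sE'Q w E'w.
  have vp : v ^+ p = 1.
    apply: (injmP inji); rewrite ?groupX ?group1 // morphX // -def_w wp.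
    by rewrite morph1.
  exists v; first by rewrite memE -?def_w.
  split=> [||_]; first by rewrite vp group1.
    by rewrite memC ?Qprod // norm_v // -def_w.
  split=> // n; apply: injC => //; first by rewrite memJ_norm ?groupX.
  by rewrite (iJX _ nQx ixJ) // -def_w.
exists C, E, v; split=> //; split=> //.
by rewrite memC.
Qed.

End Transfer.

(** The overgroup is the holomorph of Q, where R and the automorphism induced by
    y act by conjugation. *)
Lemma aut_configuration (gT : finGroupType) (p : nat) (Q : {group gT}) (y : gT)
    (R : {group {perm gT}}) :
    prime p -> p.-group Q -> y \in 'N(Q) -> p.-elt y -> y ^+ p \in Q ->
    R \subset Aut Q -> p^'.-group R -> abelian R -> R :!=: 1 ->
    conj_aut Q y \in 'N(R) -> conj_aut Q y ^+ p \in 'C(R) ->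
    'C_R[conj_aut Q y] = 1 ->
  exists2 x, x \in y *: 'Z(Q) & exists (C E : {group gT}) (v : gT),
    [/\ C \subset Q, E \subset Q & free_orbit p C E x v].
Proof.
move=> p_pr pQ nQy py Qyp sRA p'R abR ntR nRn cRnp regRn.
pose to := [Aut Q]%gact; pose i := sdpair1 to; pose j := sdpair2 to.
have Ay : conj_aut Q y \in Aut Q.
  by rewrite (subsetP (Aut_conj_aut Q 'N(Q))) ?mem_morphim.
have iJ : {in Q, forall u, i (u ^ y) = i u ^ j (conj_aut Q y)}.
  move=> u Qu; rewrite -(norm_conj_autE nQy) //; exact: (sdpair_act to).
apply: (@lift_configuration _ _ p Q y _ (j @* R)%G (j (conj_aut Q y)))
  iJ _ _ _ _ _ _ _ _ => //.
- exact: injm_sdpair1.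
- exact: morphim_pgroup.
- exact: morphim_abelian.
- exact: subset_trans (morphimS _ sRA) (im_sdpair_norm _).
- by rewrite !morph_p_elt.
- by rewrite (subsetP (morphim_norm _ _)) ?mem_morphim.
- by rewrite -morphX // (subsetP (morphim_cent _ _)) ?mem_morphim // groupX.
- by rewrite -injm_subcent1 ?injm_sdpair2 // regRn morphim1.
apply: contra ntR => cRQ; rewrite -subG1; apply/subsetP=> a Ra.
have Aa := subsetP sRA a Ra.
rewrite inE; apply/eqP/(eq_Aut Aa) => [|u Qu]; first exact: group1.
rewrite perm1; apply: (injmP (injm_sdpair1 to)) => //.
  by rewrite Aut_closed.
transitivity (i u ^ j a); first exact: (sdpair_act to Qu Aa).
apply/conjg_fixP/commgP/commute_sym.
by apply: (centsP cRQ); rewrite mem_morphim.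
Qed.

(** * The dihedral section *)

(** The square of a * b is b * b ^ a, so a * b has order 4 and b inverts it. *)
Lemma involutions_gen_D8 (gT : finGroupType) (a b : gT) :
  a ^+ 2 = 1 -> b ^+ 2 = 1 -> commute b (b ^ a) -> b * b ^ a != 1 ->
  <<[set a; b]>> \isog 'D_8.
Proof.
move=> a2 b2 cba nt_bba.
have aV : a^-1 = a by apply: (mulgI a); rewrite mulgV -a2.
have bV : b^-1 = b by apply: (mulgI b); rewrite mulgV -b2.
have ab2 : (a * b) ^+ 2 = b * b ^ a.
  by rewrite cba expgS expg1 conjgE aV !mulgA.
have oab : #[a * b] = 4.
  have: #[a * b] %| 4.
    rewrite order_dvdn (expgM _ 2 2) ab2 expgMn //.
    by rewrite -conjXg b2 conj1g mulg1.
  have: ~~ (#[a * b] %| 2) by rewrite order_dvdn ab2.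
  by case: #[_] => [|[|[|[|[|n]]]]] // _ /dvdn_leq; apply: contraTeq.
have ntb : b != 1 by apply: contra nt_bba => /eqP->; rewrite conj1g mulg1.
have nta : a != 1.
  by apply: contra nt_bba => /eqP->; rewrite conjg1 -b2.
have ob : #[b] = 2 by apply: nt_prime_order.
have oa : #[a] = 2 by apply: nt_prime_order.
have ncab : ~ commute a b.
  move=> cab; case/eqP: nt_bba; suffices -> : b ^ a = b by rewrite -b2.
  exact/conjg_fixP/commgP/commute_sym.
have ab' : (a * b) ^ b = (a * b)^-1.
  by rewrite conjgE invMg bV aV -!mulgA (b2 : b * b = 1) mulg1.
have tiab : <[a * b]> :&: <[b]> = 1.
  rewrite setIC; apply: prime_TIg; first by rewrite -orderE ob.
  apply/negP; rewrite cycle_subG => abb; apply: ncab.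
  have := centsP (cycle_abelian (a * b)) _ (cycle_id _) _ abb.
  by rewrite /commute mulgA => /mulIg.
have nab : <[b]> \subset 'N(<[a * b]>).
  by rewrite cycle_subG inE -cycleJ ab' cycleV.
have defG : <<[set a; b]>> = <[a * b]> * <[b]>.
  rewrite -norm_joinEr //; apply/eqP.
  rewrite eqEsubset gen_subG join_subG !cycle_subG subUset !sub1set.
  apply/and3P; split.
  - apply/andP; split; last by rewrite mem_gen // inE cycle_id orbT.
    rewrite -[X in X \in _](mulgK b) groupM ?groupV //.
      by rewrite mem_gen // inE cycle_id.
    by rewrite mem_gen // inE cycle_id orbT.
  - by rewrite groupM // mem_gen // !inE eqxx ?orbT.
  - by rewrite mem_gen // !inE eqxx orbT.
have := involutions_gen_dihedral oa ob; rewrite /= [#|_|](_ : _ = 8).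
  by apply; apply: contra_not_neq ncab => ->.
by rewrite defG TI_cardMg // -!orderE oab ob.
Qed.

(** One factors out (E :&: C) <x ^+ 2>: it lies in C, so it misses the norm
    v * v ^ x, and v centralizes it. *)
Lemma free_orbit_D8 (gT : finGroupType) (P C E : {group gT}) x v :
  free_orbit 2 C E x v -> x \in P -> C \subset P -> E \subset P -> ~ D8_free P.
Proof.
case=> nCx nEx Cx2 cEx2 EEC sECE Ev Cv2 nv _ Px sCP sEP.
pose N := ((E :&: C) <*> <[x ^+ 2]>)%G.
have sNC : N \subset C by rewrite join_subG subsetIr cycle_subG.
have Pv := subsetP sEP v Ev.
have nNx : x \in 'N(N).
  rewrite -cycle_subG normsY ?normsI ?cycle_subG //.
  by rewrite -cycle_subG sub_abelian_norm ?cycle_abelian ?cycle_subG ?mem_cycle.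
have nNv : v \in 'N(N).
  rewrite (subsetP (cent_sub _)) // -cycle_subG centsC join_subG.
  rewrite (subset_trans sECE) ?centS ?cycle_subG //=.
  by apply: subsetP cEx2; rewrite centS ?cycle_subG.
pose B := (<<[set x; v]>> <*> N)%G.
have nNxv : <<[set x; v]>> \subset 'N(N).
  by rewrite gen_subG subUset !sub1set nNx.
have sBP : B \subset P.
  by rewrite join_subG gen_subG subUset !sub1set Px Pv (subset_trans sNC).
have nsNB : N <| B by rewrite /normal joing_subr join_subG nNxv normG.
move/(_ B N sBP nsNB); apply.
rewrite quotientYidr // quotient_gen ?subUset ?sub1set ?nNx //.
rewrite quotientU !quotient_set1 //.
have Nu u : u \in E -> u \in C -> u \in N.
  by move=> Eu Cu; rewrite mem_gen // inE inE Eu Cu.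
have Nx2 : x ^+ 2 \in N by rewrite mem_gen // inE cycle_id orbT.
have Exv : v ^ x \in E by rewrite memJ_norm.
apply: involutions_gen_D8; rewrite -?morphX //=.
- exact: coset_id.
- by apply: coset_id; apply: Nu => //; apply: groupX.
- apply/commgP; rewrite -morphJ // -morphR ?groupJ //=.
  rewrite coset_id //; apply: Nu; first exact: groupR.
  by rewrite (subsetP EEC) // mem_commg.
rewrite -morphJ // -morphM ?groupJ //=.
apply: contra nv => /eqP/coset_idr.
rewrite groupM ?groupJ // => /(_ isT) /(subsetP sNC).
by rewrite big_ord_recr big_ord_recr big_ord0 /= mul1g expg0 conjg1.
Qed.

(** * Embedding the groups Y_m *)

Lemma Ypull_group_set p m : 1 < p -> 0 < m -> group_set (Ypull p m).
Proof.
move=> p_gt1 m_gt0; apply: pullback_group_set; first exact: wr_topM.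
by apply: Zp_redM; rewrite // -?(expn0 p) ?ltn_exp2l // dvdn_exp.
Qed.

(** For m = 1 the pull-back is taken along an isomorphism, so that the case of
    the wreath product needs no separate embedding. *)
Lemma Ypull1_isog (p : nat) : 1 < p -> Ypull p 1 \isog [set: wreath 'Z_p 'Z_p].
Proof.
move=> p_gt1; have p1_gt1 : 1 < p ^ 1 by rewrite expn1.
pose Y := Group (Ypull_group_set p_gt1 (ltn0Sn 0)).
pose pr (u : wreath 'Z_p 'Z_p * 'Z_(p ^ 1)) := u.1.
have prM : {in Y &, {morph pr : u v / u * v}} by [].
pose h := Morphism prM.
have injh : 'injm h.
  apply/injmP=> [[w c] [w' c']]; rewrite !inE /= => /eqP wc /eqP wc' /= eq_w.
  congr (_, _) => //; apply: val_inj.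
  move: wc wc'; rewrite -eq_w => -> /(congr1 val) /=.
  by rewrite !modn_small ?(leq_trans (ltn_ord _)) // Zp_cast.
have <- : h @* Y = [set: wreath 'Z_p 'Z_p].
  apply/setP=> w; rewrite inE.
  have [c cw] := Zp_red_surj p_gt1 p1_gt1 (dvdnn p) (wr_top w).
  by apply/morphimP; exists (w, c); rewrite // inE /= cw.
exact: sub_isog.
Qed.

(** The map sends ((b, f), c) to x ^+ c times the product, over i, of the
    conjugate of v by the inverse of x ^+ i raised to the power f i; it is a
    morphism because the elements of the pull-back satisfy b = c mod p.
    Products of conjugates of v are written additively in the module attached
    to V. *)
Section Embedding.
Import FiniteModule GRing.Theory.

Variables (gT : finGroupType) (p m : nat) (C V : {group gT}) (x v : gT).
Hypotheses (p_pr : prime p) (m_gt0 : 0 < m) (ox : #[x] = (p ^ m)%N).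
Hypotheses (nCx : x \in 'N(C)) (Cxp : x ^+ p \in C) (vp : v ^+ p = 1).
Hypotheses (cxpv : commute (x ^+ p) v) (abV : abelian V).
Hypotheses (nVx : x \in 'N(V)) (Vv : v \in V).
Hypothesis nNv : \prod_(i < p) v ^ (x ^+ i) \notin C.

Let M := fmod_of abV.
Let U n : M := (fmod abV v ^@ (x ^+ n))%R.

Let U_mod n : U (n %% p) = U n.
Proof.
rewrite /U [in RHS](divn_eq n p) mulnC expgD expgM actrM ?groupX //.
congr (_ ^@ _)%R; rewrite -fmodJ ?groupX //; congr (fmod _ _).
by apply/esym/conjg_fixP/commgP/commuteX/commute_sym.
Qed.

Let U_modD n : (U n *+ p = 0)%R.
Proof. by rewrite -actZr -fmodX // vp fmod1 act0r. Qed.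

Let p_gt1 : 1 < p := prime_gt1 p_pr.

Let modZ k : k %% (Zp_trunc p).+2 = k %[mod p].
Proof. by rewrite Zp_cast // modn_mod. Qed.

Let U_mulr_mod n k : (U n *+ (k %% (Zp_trunc p).+2) = U n *+ k)%R.
Proof.
rewrite Zp_cast // [in RHS](divn_eq k p) mulrnDr mulnC mulrnA U_modD.
by rewrite mul0rn add0r.
Qed.

(* p - i stands for - i: the conjugates of v depend on the exponent modulo p. *)
Let A (f : wr_base 'Z_p 'Z_p) : M := (\sum_(i : 'Z_p) U (p - i) *+ f i)%R.

Let pm_gt1 : 1 < p ^ m. Proof. by rewrite -(expn0 p) ltn_exp2l. Qed.

Let A_M f g : A (f * g) = (A f + A g)%R.
Proof.
rewrite -big_split; apply: eq_bigr => i _ /=.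
by rewrite ffunE /= U_mulr_mod mulrnDr.
Qed.

Let A_J f (b : 'Z_p) n :
  b = n %[mod p] -> A (wr_shift f b) = (A f ^@ (x ^+ n))%R.
Proof.
move=> b_n; rewrite actr_sum [RHS](reindex_inj (mulgI b)) /=.
apply: eq_bigr => i _; rewrite ffunE actZr; congr (_ *+ _)%R.
rewrite /U -actrM ?groupX // -expgD -/(U _) -/(U _).
rewrite -U_mod -[RHS]U_mod; congr U; apply/eqP.
have lt_p (j : 'Z_p) : j <= p by rewrite -[p in _ <= p]Zp_cast // ltnW.
rewrite -(eqn_modDr (i + (b * i)%g)) addnA subnK //.
rewrite [i + _]addnC addnACA subnK ?(lt_p (b * i)%g) // eqn_modDl /= modZ.
by rewrite -modnDml b_n modnDml.
Qed.

Let norm_A : val (\sum_(i : 'Z_p) U (p - i))%R = \prod_(i < p) v ^ (x ^+ i).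
Proof.
rewrite -(val_fmod_norm p abV nVx Vv); congr val.
rewrite -(big_mkord xpredT (fun i => U (p - i))) Zp_cast // big_nat_rev add0n.
rewrite -(big_mkord xpredT U) -[in LHS](prednK (prime_gt0 p_pr)).
rewrite -[in RHS](prednK (prime_gt0 p_pr)).
rewrite [RHS]big_nat_recl // big_nat_recr //=.
rewrite prednK ?prime_gt0 // addrC; congr (_ + _)%R.
  by rewrite subnn subn0 -U_mod modnn.
rewrite !big_nat; apply: eq_bigr => i /= lt_i.
by rewrite subKn ?(leq_trans lt_i) ?leq_pred.
Qed.

(** The f with A f in C form a p-group on which the top group acts.  If it is
    nontrivial, it contains a nontrivial fixed point, that is a nonzero
    constant k; but A k is the k-th power of the norm of v, which is not in
    C. *)
Let A_fixed f : val (A f) \in C -> f = 1.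
Proof.
pose K := [set f | val (A f) \in C].
have gK : group_set K.
  apply/group_setP; split=> [|f1 f2].
    rewrite inE (_ : A 1 = 0)%R ?group1 // /A big1 // => i _.
    by rewrite ffunE mulr0n.
  by rewrite !inE => C1 C2; rewrite A_M fmvalA groupM.
pose KG := Group gK; have pK : p.-group KG.
  have : p.-group [set: wr_base 'Z_p 'Z_p].
    rewrite /pgroup cardsT (_ : #|_| = (p ^ p)%N) ?pnatX ?pnat_id //.
    rewrite -[#|wr_base _ _|]/(#|{ffun 'Z_p -> 'Z_p}|) card_ffun card_ord.
    by rewrite Zp_cast.
  by apply: pgroupS; apply: subsetT.
have actsK : [acts [set: 'Z_p], on K | wr_action 'Z_p 'Z_p].
  apply/actsP=> b _ f1; rewrite !inE /= (@A_J _ _ b) // fmvalJ ?groupX //.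
  by rewrite memJ_norm ?groupX.
have pZ : p.-group [set: 'Z_p].
  by rewrite /pgroup cardsT card_ord Zp_cast // pnat_id.
move=> Cf; apply: contraTeq isT => nt_f.
have p_dv_K : p %| #|K|.
  have [] // := pgroup_pdiv pK.
  by apply/trivgPn; exists f; rewrite ?inE.
have p_dv_fix : p %| #|'Fix_(K | wr_action 'Z_p 'Z_p)([set: 'Z_p])|.
  by rewrite /dvdn -(pgroup_fix_mod pZ actsK).
have K1 : 1 \in 'Fix_(K | wr_action 'Z_p 'Z_p)([set: 'Z_p]).
  rewrite inE (group1 (Group gK)); apply/afixP=> b _.
  by apply/ffunP=> i; rewrite !ffunE.
have [f0 /setIP[Kf0 /afixP fix_f0] nt_f0] : exists2 f0,
    f0 \in 'Fix_(K | wr_action 'Z_p 'Z_p)([set: 'Z_p]) & f0 != 1.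
  apply/exists_inP; apply: contraLR p_dv_fix => /exists_inPn all1.
  rewrite (_ : 'Fix_(K | _)(_) = [set 1]).
    by rewrite cards1 dvdn1 neq_ltn p_gt1 orbT.
  apply/eqP; rewrite eqEsubset sub1set K1 andbT; apply/subsetP=> g /all1.
  by rewrite inE => /negPn.
have f0E i : f0 i = f0 1.
  by have /ffunP/(_ 1) := fix_f0 i (in_setT _); rewrite ffunE mulg1.
have A_f0 : (A f0 = (\sum_(i : 'Z_p) U (p - i)) *+ f0 1%g)%R.
  by rewrite -sumrMnl; apply: eq_bigr => i _; rewrite f0E.
have f01_gt0 : 0 < f0 1.
  rewrite lt0n; apply: contraNneq nt_f0 => f01; apply/eqP/ffunP=> i.
  by rewrite f0E ffunE; apply: val_inj.
case/negP: nNv; apply: (@mem_exp_coprime _ _ _ (f0 1) p) => //.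
- by rewrite coprime_sym prime_coprime // gtnNdvd // -[p in _ < p]Zp_cast.
- by rewrite -norm_A -fmvalZ -A_f0; rewrite inE in Kf0.
by rewrite -norm_A -fmvalZ -sumrMnl big1 ?group1 // => i _; rewrite U_modD.
Qed.

Let phi (u : wreath 'Z_p 'Z_p * 'Z_(p ^ m)) : gT := x ^+ u.2 * val (A u.1.2).

Let Y := Group (Ypull_group_set p_gt1 m_gt0).

Let xmod k : x ^+ (k %% (Zp_trunc (p ^ m)).+2) = x ^+ k.
Proof. by rewrite Zp_cast // -ox expg_mod_order. Qed.

Let top_mod (w : wreath 'Z_p 'Z_p) (c : 'Z_(p ^ m)) :
  wr_top w = Zp_red p c -> w.1 = c %[mod p].
Proof. by move=> /(congr1 val) /= ->; apply: modZ. Qed.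

Let phiM : {in Y &, {morph phi : u w / u * w}}.
Proof.
move=> [w c] [w' c']; rewrite !inE /= => _ /eqP top_w'.
rewrite /phi /= (A_M (wr_shift w.2 w'.1) w'.2) xmod expgD fmvalA.
rewrite (@A_J _ _ c'); last by rewrite (top_mod top_w').
by rewrite fmvalJ ?groupX // conjgE !mulgA mulgK.
Qed.

(** If x ^+ c * A f = 1, then x ^+ c centralizes v.  Were c prime to p, so would
    x, and the norm of v would be v ^+ p = 1.  Hence x ^+ c lies in C, and f is
    trivial by A_fixed. *)
Let inj_phi : 'injm (Morphism phiM).
Proof.
apply/subsetP=> [[w c]] /morphpreP[]; rewrite inE => /eqP top_w /set1P phi1.
have xcE : x ^+ c = (val (A w.2))^-1.
  by apply: (mulIg (val (A w.2))); rewrite mulVg.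
have p_dv_c : p %| c.
  apply: contraR nNv; rewrite -prime_coprime // coprime_sym => co_cp.
  have cxv : x \in 'C[v].
    apply: (@mem_exp_coprime _ _ _ c p) => //; last exact/cent1P.
    - rewrite lt0n; apply: contraTneq co_cp => ->.
      by rewrite /coprime gcd0n neq_ltn p_gt1 orbT.
    - by rewrite xcE groupV; apply/cent1P/(centsP abV); rewrite ?fmodP.
  rewrite (eq_bigr (fun _ => v)); last first.
    by move=> i _; apply/conjg_fixP/commgP/commute_sym/cent1P/groupX.
  by rewrite prodg_const card_ord vp.
have w2 : w.2 = 1.
  by apply: A_fixed; rewrite -groupV -xcE -(divnK p_dv_c) mulnC expgM groupX.
have c0 : c = 1.
  move: xcE; rewrite w2 (_ : A 1 = 0)%R; last first.
    by rewrite /A big1 // => i _; rewrite ffunE mulr0n.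
  rewrite invg1 => /eqP; rewrite -order_dvdn ox => dv_c; apply: val_inj => /=.
  apply/eqP; apply: contraTT dv_c; rewrite -lt0n => c_gt0; rewrite gtnNdvd //.
  by rewrite -[X in _ < X]Zp_cast.
have w1 : w.1 = 1.
  by apply: val_inj; rewrite -[w.1]/(wr_top w) top_w c0 /= mod0n.
rewrite inE; apply/eqP; congr (_, _) => //; apply: val_inj.
by rewrite [LHS]surjective_pairing [X in (X, _)]w1 [X in (_, X)]w2.
Qed.

Lemma Ypull_embed :
  exists Q : {group gT}, Q \subset <[x]> <*> V /\ Q \isog Ypull p m.
Proof.
exists (Morphism phiM @* Y)%G; split; last first.
  by rewrite (isog_sym _ Y); apply: sub_isog.
apply/subsetP=> _ /morphimP[[w c] _ _ ->] /=; rewrite groupM //.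
  by rewrite mem_gen // inE mem_cycle.
by rewrite mem_gen // inE fmodP orbT.
Qed.

End Embedding.

Lemma free_orbit_slim (gT : finGroupType) p (P C E : {group gT}) x v :
    prime p -> odd p -> p.-elt x -> free_orbit p C E x v ->
    x \in P -> E \subset P -> ~ slim p P.
Proof.
move=> p_pr p_odd px [nCx _ Cxp cExp _ _ Ev _ nv /(_ p_odd)[vp cv]].
move=> Px sEP slimP.
have [m ox] := p_natP px.
pose V := <<v ^: <[x]> >>%G.
have Vv : v \in V by rewrite mem_gen // class_refl.
have abV : abelian V.
  rewrite abelian_gen; apply/centsP=> _ /imsetP[y1 Xy1 ->] _ /imsetP[y2 Xy2 ->].
  have /cycleP[n def_n]: y2 * y1^-1 \in <[x]> by rewrite groupM ?groupV.
  have -> : v ^ y2 = (v ^ (x ^+ n)) ^ y1 by rewrite -def_n -conjgM mulgKV.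
  by rewrite /commute -!conjMg cv.
have nVx : x \in 'N(V).
  by rewrite -cycle_subG norms_gen // class_norm.
have sVP : V \subset P.
  rewrite gen_subG class_subG ?cycle_subG //.
  exact: subsetP sEP v Ev.
have m_gt0 : 0 < m.
  rewrite lt0n; apply: contraNneq nv => m0; rewrite m0 in ox.
  have x1 : x = 1 by apply/eqP; rewrite -order_eq1 ox.
  rewrite (eq_bigr (fun _ => v)) => [|i _]; last by rewrite x1 expg1n conjg1.
  by rewrite prodg_const card_ord vp.
have cxpv : commute (x ^+ p) v by apply: (centP cExp).
have [Q [sQ isoQ]] := Ypull_embed p_pr m_gt0 ox nCx Cxp vp cxpv abV nVx Vv nv.
have sQP : Q \subset P by rewrite (subset_trans sQ) // join_subG cycle_subG Px.
have [noY1 noYm] := slimP Q sQP.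
case: m m_gt0 ox isoQ => [|[|m]] // m_gt0 _ isoQ; last exact: noYm isoQ.
apply: noY1; pose Y := Group (Ypull_group_set (prime_gt1 p_pr) m_gt0).
exact: (@isog_trans _ _ _ _ Y [set: _]%G isoQ (Ypull1_isog (prime_gt1 p_pr))).
Qed.

(** * Coprime subgroups from a strongly embedded p-subgroup *)

(** H / I is a Frobenius group with complement S / I.  Take a nontrivial Sylow
    subgroup T of the preimage K0 of its kernel, for a prime other than p.  By
    the Frattini argument the normalizer of T in H covers H / K0, so it contains
    a p-element of order p modulo K0; its p-th power lies in I, because K0 / I
    is a p'-group.  Conjugate this element into S, which is a Sylow subgroup,
    and let R be the corresponding conjugate of Z(T). *)
Lemma strongly_embedded_coprime_action (gT : finGroupType) (p : nat)
    (H I S : {group gT}) :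
    prime p -> I <| H -> I \subset S -> S \subset H -> p.-group S ->
    ~~ (S \subset I) -> ~~ (H \subset S) ->
    (forall h, h \in H -> h \notin S -> S :&: S :^ h \subset I) ->
  exists2 n, n \in S & exists R : {group gT},
    [/\ n \notin I, n ^+ p \in I, n \in 'N(R), R \subset H
      & [/\ p^'.-group R, abelian R & R :!=: 1]].
Proof.
move=> p_pr nsIH sIS sSH pS ntS nHS tiS.
have nIH := normal_norm nsIH.
have nIS := subset_trans sSH nIH.
have ntSI : S / I != 1 by rewrite -subG1 quotient_sub1.
have frob : [Frobenius H / I with complement S / I].
  apply/andP; split.
    apply: contra nHS => /eqP eqHS.
    by rewrite -(quotientSGK nIH sIS) eqHS.
  apply/normedTI_memJ_P; split.
  - by rewrite setD_eq0 subG1.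
  - exact: quotientS.
  have memS h : h \in H -> (coset I h \in S / I) = (h \in S).
    move=> Hh; apply/idP/idP => [Sh|]; last exact: mem_quotient.
    by rewrite -(quotientGK (normalS sIS sSH nsIH)) mem_morphpre ?(subsetP nIH).
  move=> a g /setD1P[nt_a Sa] /morphimP[h Nh Hh def_g].
  have /morphimP[s Ns Ss def_a] := Sa.
  have Hsh : s ^ h \in H by rewrite groupJ // (subsetP sSH).
  rewrite !inE conjg_eq1 nt_a def_g def_a -morphJ //.
  rewrite (memS _ Hsh) (memS _ Hh) /=.
  apply/idP/idP=> [Ssh | Sh]; last exact: groupJ.
  apply: contraR nt_a => notSh.
  rewrite def_a -(conjg_eq1 _ (coset I h)) -morphJ //=.
  by rewrite coset_id // (subsetP (tiS h Hh notSh)) // inE Ssh memJ_conjg.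
have [K frobK] := Frobenius_kernel_exists frob.
have [defH ntK _ _ _] := Frobenius_context frobK.
have coKS : coprime #|K| #|S / I| := Frobenius_coprime frobK.
have [nsKH _ mulKS _ tiKS] := sdprod_context defH.
pose K0 := (coset I @*^-1 K)%G.
have sKH := normal_sub nsKH.
have nsK0H : K0 <| H by rewrite -(quotientGK nsIH) cosetpre_normal.
have [sK0H nK0H] := andP nsK0H.
have sIK0 : I \subset K0 by apply: sub_cosetpre.
have nIK0 := subset_trans sK0H nIH.
have defK : K0 / I = K by rewrite cosetpreK.
have pSI : p.-group (S / I) := quotient_pgroup I pS.
have p'K : p^'.-group K.
  have [_ p_dv _] := pgroup_pdiv pSI ntSI.
  rewrite /pgroup p'natE // -prime_coprime // coprime_sym.
  exact: coprime_dvdr p_dv coKS.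
have sylS : p.-Sylow(H) S.
  have [sSIH oH] := (quotientS I sSH, sdprod_card defH).
  rewrite /pHall sSH pS -(index_quotient_eq _ sSH nIH); last first.
    by rewrite (subset_trans _ sIS) ?subsetIr.
  by rewrite -divgS // -oH mulnK ?cardG_gt0.
have [r r_pr r_dv_K] : exists2 r, prime r & r %| #|K|.
  by exists (pdiv #|K|); rewrite ?pdiv_dvd ?pdiv_prime // cardG_gt1.
have r_dv_K0 : r %| #|K0|.
  by rewrite (dvdn_trans r_dv_K) // -defK dvdn_quotient.
have ne_rp : r != p.
  apply: contraTneq r_dv_K => ->.
  by rewrite -p'natE.
have [T sylT] := Sylow_exists r K0.
have ntT : T :!=: 1.
  rewrite -cardG_gt1 (card_Hall sylT) p_part_gt1 mem_primes r_pr r_dv_K0.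
  by rewrite cardG_gt0.
have rT := pHall_pgroup sylT.
have p'T : p^'.-group T by apply: sub_in_pnat rT => q _ /eqnP->.
have frat := Frattini_arg nsK0H sylT.
have ntSK0 : ~~ (H \subset K0).
  apply: contra ntSI => sHK0; rewrite -subG1 -tiKS subsetI subxx andbT -defK.
  by rewrite quotientS // (subset_trans sSH).
have pHK0 : p.-group (H / K0).
  rewrite /pgroup card_quotient // -(index_quotient_eq _ sK0H nIH); last first.
    by rewrite (subset_trans _ sIK0) ?subsetIr.
  by rewrite defK -divgS // -(sdprod_card defH) mulKn ?cardG_gt0.
have ntHK0 : H / K0 != 1 by rewrite -subG1 quotient_sub1.
have [_ p_dv _] := pgroup_pdiv pHK0 ntHK0.
have [a0 Ha0 oa0] := Cauchy p_pr p_dv.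
have: a0 \in 'N_H(T) / K0 by rewrite -quotientMidl frat.
case/morphimP=> n0 Nn0 /setIP[Hn0 nTn0] def_a0.
(* Passing to the p-part does not change the coset, of order p. *)
pose n1 := n0.`_p.
have def_n1 : coset K0 n1 = a0.
  rewrite /n1 morph_constt // -def_a0 constt_p_elt // /p_elt oa0 pnat_id //.
have Hn1 : n1 \in H by rewrite groupX.
have nTn1 : n1 \in 'N(T) by rewrite groupX.
have pn1 : p.-elt n1 by apply: p_elt_constt.
have K0n1p : n1 ^+ p \in K0.
  rewrite coset_idr ?groupX ?(subsetP nK0H) // morphX ?(subsetP nK0H) //=.
  by rewrite def_n1 -oa0 expg_order.
have In1p : n1 ^+ p \in I.
  have Nn1p : n1 ^+ p \in 'N(I) by rewrite groupX ?(subsetP nIH).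
  rewrite coset_idr //; apply/eqP; rewrite -order_eq1.
  have pn1I : p.-elt (coset I (n1 ^+ p)) by rewrite morph_p_elt // p_eltX.
  have p'n1I : p^'.-elt (coset I (n1 ^+ p)).
    by rewrite (mem_p_elt p'K) // -defK mem_quotient.
  by rewrite (pnat_1 pn1I p'n1I).
have nIn1 : n1 \notin I.
  apply: contraL p_pr => /(subsetP sIK0) K0n1.
  by rewrite -oa0 -def_n1 coset_id // order1.
have sn1H : <[n1]> \subset H by rewrite cycle_subG.
have [x Hx sJS] := Sylow_Jsub sylS sn1H pn1.
exists (n1 ^ x); first by rewrite (subsetP sJS) ?memJ_conjg ?cycle_id.
exists ('Z(T) :^ x)%G; split.
- by rewrite memJ_norm ?(subsetP (normal_norm nsIH)).
- by rewrite -conjXg memJ_norm ?(subsetP (normal_norm nsIH)).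
- by rewrite normJ memJ_conjg (subsetP (char_norms (center_char T))).
- rewrite -(conjGid Hx) conjSg (subset_trans (center_sub T)) //.
  exact: subset_trans (pHall_sub sylT) sK0H.
split.
- by rewrite pgroupJ (pgroupS (center_sub T)).
- by rewrite abelianJ center_abelian.
by rewrite -(conjs1g x) (can_eq (conjsgK x)) center_nil_eq1 ?(pgroup_nil rT).
Qed.

(** * Saturated fusion systems *)

Section Fusion.

Variables (gT : finGroupType) (p : nat) (P : {group gT}) (F : hom_system gT).
Hypotheses (p_pr : prime p) (pP : p.-group P) (satF : saturated p P F).
Implicit Types (Q R S T : {group gT}) (f g : gT -> gT).

Let catF := sat_category satF.

Lemma F_id Q R : Q \subset P -> R \subset P -> Q \subset R -> F Q R id.
Proof. exact: sat_incl satF Q R. Qed.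

Lemma F_ext Q R f g : Q \subset P -> R \subset P -> {in Q, f =1 g} ->
  F Q R f -> F Q R g.
Proof. by move=> sQP sRP eq_fg; rewrite (fcat_ext catF sQP sRP eq_fg). Qed.

Lemma F_comp Q R S f g : Q \subset P -> R \subset P -> S \subset P ->
  F Q R f -> F R S g -> F Q S (g \o f).
Proof. exact: fcat_comp catF Q R S f g. Qed.

Lemma F_widen Q R f : Q \subset P -> R \subset P -> F Q R f -> F Q P f.
Proof.
move=> sQP sRP Ff.
by apply: F_comp sQP sRP (subxx P) Ff (F_id sRP (subxx P) sRP).
Qed.

Lemma F_inj Q R f : Q \subset P -> R \subset P -> F Q R f -> injhom Q R f.
Proof. exact: fcat_injhom catF Q R f. Qed.

Lemma img_eq Q R f : Q \subset P -> R \subset P -> F Q R f -> f @: Q = R ->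
  img f Q = R.
Proof.
move=> sQP sRP Ff fQ; apply: val_inj.
by rewrite /= (imgE (injhomM (F_inj sQP sRP Ff))); apply: fQ.
Qed.

Lemma F_inverse Q R f : Q \subset P -> R \subset P -> F Q R f -> f @: Q = R ->
  exists2 g, F R Q g & {in Q, cancel f g} /\ {in R, cancel g f}.
Proof.
move=> sQP sRP Ff fQ; have [fM injf _] := F_inj sQP sRP Ff.
have [_ invF] := sat_iso satF sQP sRP Ff.
pose g u := odflt 1 [pick w in Q | f w == u].
have fK : {in Q, cancel f g}.
  move=> w Qw; rewrite /g.
  case: pickP => [w' /andP[Qw' /eqP/injf->] // | /(_ w)].
  by rewrite Qw eqxx.
exists g; first by rewrite -(img_eq sQP sRP Ff fQ); apply: invF.
by split=> // u; rewrite -fQ => /imsetP[w Qw ->]; rewrite fK.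
Qed.

Lemma F_iso_card Q R f : Q \subset P -> R \subset P -> F Q R f ->
  #|R| <= #|Q| -> f @: Q = R.
Proof.
move=> sQP sRP Ff sz; have [fM injf sfR] := F_inj sQP sRP Ff.
by apply/eqP; rewrite eqEcard sfR card_in_imset.
Qed.

Lemma F_perm Q g : Q \subset P -> F Q Q g ->
  exists2 b, b \in Aut_F F Q & {in Q, g =1 b}.
Proof.
move=> sQP Fg; have [gM injg sgQ] := F_inj sQP sQP Fg.
pose h := Morphism gM.
have injh : 'injm h by apply/injmP.
have hQ : h @* Q = Q by rewrite morphimEdom; apply: (F_iso_card sQP sQP Fg).
exists (aut injh hQ); last by move=> u Qu; rewrite autE.
apply/setIdP; split; [exact: Aut_aut | apply: F_ext Fg => // u Qu].
by rewrite autE.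
Qed.

Lemma Aut_F_group_set Q : Q \subset P -> group_set (Aut_F F Q).
Proof.
move=> sQP; apply/group_setP; split=> [|a b].
  apply/setIdP; split; first exact: group1.
  apply: (F_ext sQP sQP _ (F_id sQP sQP (subxx _))).
  by move=> u _; rewrite perm1.
case/setIdP=> Aa Fa /setIdP[Ab Fb]; apply/setIdP; split; first exact: groupM.
by apply: (F_ext sQP sQP _ (F_comp sQP sQP sQP Fa Fb)) => u _; rewrite permM.
Qed.

Lemma Aut_P_sub_F Q : Q \subset P -> Aut_P P Q \subset Aut_F F Q.
Proof.
move=> sQP; apply/subsetP=> _ /morphimP[x Nx /setIP[Px _] ->].
apply/setIdP; split.
  by rewrite (subsetP (Aut_conj_aut Q 'N(Q))) ?mem_morphim.
apply: (sat_conj satF) => //; apply/exists_inP; exists x => //.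
rewrite (normP Nx) subxx; apply/forall_inP=> u Qu.
by rewrite norm_conj_autE.
Qed.

Lemma Hom_P_conjP Q R f :
  reflect (exists2 x, x \in P & Q :^ x \subset R /\ {in Q, f =1 conjg^~ x})
          (Hom_P P Q R f).
Proof.
apply: (iffP exists_inP) => [[x Px p0] | [x Px [sQxR fx]]]; exists x => //.
  by case/andP: p0 => sQxR /forall_inP fx; split=> // u Qu; apply/eqP/fx.
by rewrite sQxR; apply/forall_inP=> u Qu; rewrite fx.
Qed.

Lemma mem_N_phi Q f x b : x \in 'N_P(Q) -> b \in Aut_P P (img f Q) ->
  {in Q, forall u, f (u ^ x) = b (f u)} -> x \in N_phi P Q f.
Proof.
move=> NPx Ab fx; have /setIP[Px Nx] := NPx.
have Ax : conj_aut Q x \in Aut Q.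
  by rewrite (subsetP (Aut_conj_aut Q 'N(Q))) ?mem_morphim.
apply/setIP; split=> //; rewrite mem_morphpre //=; apply/setIP; split.
  exact: mem_morphim.
apply/setIdP; split=> //.
apply/exists_inP; exists b => //; apply/forall_inP=> u Qu.
by rewrite norm_conj_autE // fx.
Qed.

(** The hypothesis on b says that x lies in N_phi; so N_phi is larger than Q,
    and the extension of f provided by saturation is conjugation by an element of
    P. *)
Lemma extend_to_larger Q R f x b :
    (forall T g, T \subset P -> #|Q| < #|T| -> F T P g -> Hom_P P T P g) ->
    Q \subset P -> R \subset P -> F Q R f -> f @: Q = R ->
    fully_normalized P F R -> x \in 'N_P(Q) -> x \notin Q -> b \in Aut_P P R ->
    {in Q, forall u, f (u ^ x) = b (f u)} ->
  Hom_P P Q P f.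
Proof.
move=> IH sQP sRP Ff fQ fnR NPx notQx Ab fx.
have defR := img_eq sQP sRP Ff fQ; have [fM injf sfR] := F_inj sQP sRP Ff.
have [|g Fg eq_gf] := sat_ext satF sQP (F_widen sQP sRP Ff).
  by rewrite defR.
have Nfx : x \in N_phi P Q f by apply: mem_N_phi fx; rewrite ?defR.
have sQN : Q \subset N_phi P Q f.
  apply/subsetP=> q Qq; have Rfq : f q \in R by rewrite -fQ imset_f.
  apply: (@mem_N_phi _ _ _ (conj_aut R (f q))).
  - by rewrite in_setI (subsetP sQP) // (subsetP (normG Q)).
  - rewrite defR; apply: mem_morphim; first exact: (subsetP (normG R)).
    by rewrite in_setI (subsetP sRP) // (subsetP (normG R)).
  move=> u Qu; rewrite norm_conj_autE ?(subsetP (normG R)) -?fQ ?imset_f //.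
  exact: (morphJ (Morphism fM)).
have sNP : N_phi P Q f \subset P.
  by apply: subset_trans (subsetIl _ _) (subsetIl _ _).
have ltQN : #|Q| < #|N_phi P Q f|.
  by rewrite proper_card // properE sQN; apply/subsetPn; exists x.
have /Hom_P_conjP[z Pz [_ gz]] := IH _ g sNP ltQN Fg.
apply/Hom_P_conjP; exists z => //; split; first by rewrite -(conjGid Pz) conjSg.
by move=> u Qu; rewrite -eq_gf // gz // (subsetP sQN).
Qed.

Lemma proper_normalizer Q : Q \subset P -> #|Q| < #|P| ->
  exists2 x, x \in 'N_P(Q) & x \notin Q.
Proof.
move=> sQP ltQP; have prQP : Q \proper P by rewrite properEcard sQP.
have := nilpotent_proper_norm (pgroup_nil pP) prQP.
by rewrite properE => /andP[_ /subsetPn[x]]; exists x.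
Qed.

(** Maximize |N_P(R)| over the R isomorphic to Q in F; morphisms are taken among
    finite functions to make this a decidable condition. *)
Lemma fully_normalized_conj Q : Q \subset P ->
  exists R f, [/\ R \subset P, F Q R f, f @: Q = R & fully_normalized P F R].
Proof.
move=> sQP.
pose isoQ R := (R \subset P)
  && [exists f : {ffun gT -> gT}, F Q R f && (f @: Q == R)].
have isoQQ : isoQ Q.
  rewrite /isoQ sQP; apply/existsP; exists (finfun id); apply/andP; split.
    by apply: F_ext (F_id sQP sQP (subxx _)) => // u _; rewrite ffunE.
  by rewrite (eq_imset _ (ffunE id)) imset_id.
case: (arg_maxnP (fun R : {group gT} => #|'N_P(R)|) isoQQ) => R /andP[sRP].
case/existsP=> f /andP[Ff /eqP fQ] maxR; exists R, f; split=> // R' sR'P.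
case=> g [h [Fg Fh gK hK]].
apply: maxR; rewrite /isoQ sR'P; apply/existsP; exists (finfun (g \o f)).
have gR : g @: R = R'.
  have [[_ _ sgR'] [_ _ shR]] := (F_inj sRP sR'P Fg, F_inj sR'P sRP Fh).
  apply/eqP; rewrite eqEsubset sgR'; apply/subsetP=> u R'u.
  by rewrite -(hK u R'u) imset_f // (subsetP shR) ?imset_f.
rewrite (eq_imset _ (ffunE _)) imset_comp fQ gR eqxx andbT.
by apply: (F_ext sQP sR'P _ (F_comp sQP sRP sR'P Ff Fg)) => u _; rewrite ffunE.
Qed.

Section Minimal.

Variable R : {group gT}.
Hypotheses (sRP : R \subset P) (ltRP : #|R| < #|P|).
Hypothesis fnR : fully_normalized P F R.
Hypothesis IH :
  forall T g, T \subset P -> #|R| < #|T| -> F T P g -> Hom_P P T P g.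

Let H := Group (Aut_F_group_set sRP).

(** The hypotheses say that phi extends to a subgroup containing x, where it is
    conjugation by an element of P, which then normalizes R. *)
Lemma Aut_F_strongly_embedded phi x :
    phi \in Aut_F F R -> x \in 'N_P(R) -> x \notin R ->
    conj_aut R x ^ phi \in Aut_P P R ->
  phi \in Aut_P P R.
Proof.
case/setIdP=> Aphi Fphi NPx notRx Sx; have /setIP[Px Nx] := NPx.
have phiR : phi @: R = R by apply: (F_iso_card sRP sRP Fphi).
have /Hom_P_conjP[z Pz [_ phi_z]] : Hom_P P R P phi.
  apply: (extend_to_larger IH sRP sRP Fphi phiR fnR NPx notRx Sx) => u Ru.
  by rewrite !permM permK norm_conj_autE.
have Nz : z \in 'N(R).
  rewrite inE; apply/subsetP=> _ /imsetP[u Ru ->].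
  by rewrite -phi_z // Aut_closed.
suffices -> : phi = conj_aut R z by rewrite mem_morphim // inE Pz.
apply: (eq_Aut Aphi) => [|u Ru]; last by rewrite norm_conj_autE // phi_z.
by rewrite (subsetP (Aut_conj_aut R 'N(R))) ?mem_morphim.
Qed.

(** Carried over to R by f, the action of any x in N_P(Q) is in Aut_F(R), hence
    in Aut_P(R); so f extends beyond Q. *)
Lemma Hom_F_into_R Q f : Aut_F F R \subset Aut_P P R ->
    Q \subset P -> F Q R f -> f @: Q = R -> #|Q| = #|R| -> Hom_P P Q P f.
Proof.
move=> sHS sQP Ff fQ oQ.
have [|x NPx notQx] := proper_normalizer sQP; first by rewrite oQ.
have /setIP[Px Nx] := NPx; have [fM injf sfR] := F_inj sQP sRP Ff.
have [g Fg [fK gK]] := F_inverse sQP sRP Ff fQ.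
have Fx : F Q Q (fun u => u ^ x).
  apply: (sat_conj satF) => //; apply/Hom_P_conjP; exists x => //.
  by rewrite (normP Nx).
have [b Hb def_b] :=
  F_perm sRP (F_comp sRP sQP sRP Fg (F_comp sQP sQP sRP Fx Ff)).
apply: (extend_to_larger _ sQP sRP Ff fQ fnR NPx notQx (subsetP sHS b Hb)).
  by rewrite oQ.
by move=> u Qu; rewrite -def_b /= ?fK // -fQ imset_f.
Qed.

(** Let H = Aut_F(R), S = Aut_P(R) and I = Inn(R).  An x in N_P(R) outside R
    whose action is inner would yield an element outside R acting trivially,
    and then Aut_F_strongly_embedded, with trivial action, gives H = S. *)
Lemma local_free_orbit : ~~ (Aut_F F R \subset Aut_P P R) ->
  exists2 x, x \in P & exists (C E : {group gT}) v,
    [/\ C \subset P, E \subset P & free_orbit p C E x v].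
Proof.
move=> notHS; pose S := [group of Aut_P P R]; pose I := (conj_aut R @* R)%G.
have nRR := normG R; have pR := pgroupS sRP pP.
have sSH : S \subset H by apply: Aut_P_sub_F.
have sIS : I \subset S by rewrite morphimS // subsetI sRP.
have IJ phi a : phi \in H -> a \in I -> a ^ phi \in I.
  case/setIdP=> Aphi _ /morphimP[q Nq Rq ->]; have Rphiq := Aut_closed Aphi Rq.
  suffices ->: conj_aut R q ^ phi = conj_aut R (phi q).
    by rewrite mem_morphim // (subsetP nRR).
  have AR z : z \in R -> conj_aut R z \in Aut R.
    move=> Rz; rewrite (subsetP (Aut_conj_aut R R)) // mem_morphim //.
    exact: subsetP nRR z Rz.
  apply: (@eq_Aut _ R); rewrite ?groupJ ?AR // => u Ru.
  have Ru' : phi^-1 u \in R by rewrite -[phi^-1]/(phi^-1)%g Aut_closed ?groupV.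
  rewrite !permM !norm_conj_autE ?(subsetP nRR) //.
  by have := morphJ (autm_morphism Aphi) Ru' Rq; rewrite /= !autmE permKV.
have nsIH : I <| H.
  rewrite /normal (subset_trans sIS sSH); apply/subsetP=> phi Hphi.
  by rewrite inE; apply/subsetP=> _ /imsetP[a Ia ->]; apply: IJ.
have memI x : x \in 'N_P(R) -> conj_aut R x \in I -> x \in R.
  move=> NPx /morphimP[q Nq Rq eq_xq]; apply: contraR notHS => notRx.
  have /setIP[Px Nx] := NPx.
  apply/subsetP=> phi Hphi.
  apply: (@Aut_F_strongly_embedded _ (x * q^-1)) => //.
  - by rewrite groupM // inE groupV (subsetP sRP) // groupV.
  - by rewrite groupMr ?groupV.
  by rewrite morphM ?groupV // morphV //= eq_xq mulgV conj1g group1.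
have tiS phi : phi \in H -> phi \notin S -> S :&: S :^ phi \subset I.
  move=> Hphi notSphi; apply/subsetP=> b /setIP[Sb /imsetP[a Sa def_b]].
  rewrite def_b; apply: IJ => //; have /morphimP[x Nx NPx def_a] := Sa.
  rewrite def_a; apply: mem_morphim => //; apply: contraR notSphi => notRx.
  by apply: (Aut_F_strongly_embedded Hphi NPx notRx); rewrite -def_a -def_b.
have pS : p.-group S by rewrite morphim_pgroup // (pgroupS (subsetIl _ _)).
have ntS : ~~ (S \subset I).
  have [x NPx notRx] := proper_normalizer sRP ltRP.
  apply: contra notRx => sSI; apply: memI => //; apply: (subsetP sSI).
  by rewrite mem_morphim //; case/setIP: NPx.
have [n Sn [A [notIn Inp nAn sAH [p'A abA ntA]]]] :=
  strongly_embedded_coprime_action p_pr nsIH sIS sSH pS ntS notHS tiS.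
have /morphimP[y Ny NPy def_n] := Sn; have /setIP[Py _] := NPy.
have notRy : y \notin R by apply: contra notIn => Ry; rewrite def_n mem_morphim.
have Ryp : y ^+ p \in R.
  by apply: memI; rewrite ?groupX // morphX // -def_n.
have regAn : 'C_A[n] = 1.
  apply/trivgP/subsetP=> a /setIP[Aa /cent1P can].
  have Sa : a \in S.
    apply: (Aut_F_strongly_embedded (subsetP sAH a Aa) NPy notRy).
    by rewrite -def_n (conjg_fixP _) //; apply/commgP/commute_sym.
  by rewrite inE -order_eq1 (pnat_1 (mem_p_elt pS Sa) (mem_p_elt p'A Aa)).
have cAnp : n ^+ p \in 'C(A).
  apply/centP=> a Aa; apply/commgP; rewrite -in_set1 -set1gE.
  have coIA : coprime #|I| #|A| by apply: pnat_coprime (pgroupS sIS pS) p'A.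
  rewrite -(coprime_TIg coIA); apply/setIP; split.
    rewrite commgEl groupM ?groupV // memJ_norm //.
    by rewrite (subsetP (normal_norm nsIH)) // (subsetP sAH).
  by rewrite commgEr groupM // memJ_norm ?groupV ?groupX.
have sAA : A \subset Aut R.
  by rewrite (subset_trans sAH) //; apply/subsetP=> a /setIdP[].
have py : p.-elt y := mem_p_elt pP Py.
rewrite def_n in nAn cAnp regAn.
have [x yZx [C [E [v [sCR sER orbv]]]]] :=
  aut_configuration p_pr pR Ny py Ryp sAA p'A abA ntA nAn cAnp regAn.
exists x; last by exists C, E, v; rewrite !(subset_trans _ sRP).
case/lcosetP: yZx => z Zz ->; rewrite groupM // (subsetP sRP) //.
by rewrite (subsetP (center_sub R)).
Qed.

End Minimal.

(** Descending induction on |Q|: two F-isomorphisms onto a fully normalized R,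
    one from Q and one from f(Q), are conjugations, hence so is f. *)
Lemma F_trivial Q f :
    (forall g, F P P g -> Hom_P P P P g) ->
    (forall (C E : {group gT}) x v, C \subset P -> E \subset P -> x \in P ->
      ~ free_orbit p C E x v) ->
  Q \subset P -> F Q P f -> Hom_P P Q P f.
Proof.
move=> HP no_orbit; have [k] := ubnP (#|P| - #|Q|).
elim: k Q f => // k IHk Q f /ltnSE le_k sQP Ff.
have [eq_QP | neq_QP] := eqVneq Q P; first by rewrite eq_QP in Ff *; apply: HP.
have ltQP : #|Q| < #|P| by rewrite proper_card // properEneq neq_QP.
have IHQ T g : T \subset P -> #|Q| < #|T| -> F T P g -> Hom_P P T P g.
  move=> sTP ltQT; apply: IHk => //; rewrite (leq_trans _ le_k) //.
  exact: ltn_sub2l.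
have [R [f0 [sRP Ff0 f0Q fnR]]] := fully_normalized_conj sQP.
have [_ injf0 _] := F_inj sQP sRP Ff0.
have oR : #|R| = #|Q| by rewrite -f0Q card_in_imset.
have ltRP : #|R| < #|P| by rewrite oR.
have IHR T g : T \subset P -> #|R| < #|T| -> F T P g -> Hom_P P T P g.
  by rewrite oR; apply: IHQ.
have sHS : Aut_F F R \subset Aut_P P R.
  apply: contraT => /(local_free_orbit sRP ltRP fnR IHR)[x Px].
  case=> C [E [v [sCP sEP orb]]].
  by case: (no_orbit C E x v).
have /Hom_P_conjP[a Pa [_ f0a]] :=
  Hom_F_into_R sRP ltRP fnR IHR sHS sQP Ff0 f0Q (esym oR).
have [fM injf sfP] := F_inj sQP (subxx P) Ff; pose Q1 := img f Q.
have defQ1 : Q1 = f @: Q :> {set gT} := imgE fM.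
have sQ1P : Q1 \subset P by rewrite defQ1.
have [Ff1 _] := sat_iso satF sQP (subxx P) Ff.
have [g Fg [fK gK]] := F_inverse sQP sQ1P Ff1 (esym defQ1).
have Fh := F_comp sQ1P sQP sRP Fg Ff0.
have oQ1 : #|Q1| = #|R| by rewrite defQ1 card_in_imset.
have hQ1 : (f0 \o g) @: Q1 = R by apply: F_iso_card Fh _; rewrite ?oQ1.
have /Hom_P_conjP[b Pb [_ hb]] :=
  Hom_F_into_R sRP ltRP fnR IHR sHS sQ1P Fh hQ1 oQ1.
have Pab : a * b^-1 \in P by rewrite groupM ?groupV.
apply/Hom_P_conjP; exists (a * b^-1) => //; split.
  by rewrite -(conjGid Pab) conjSg.
move=> u Qu; apply: (conjg_inj b); rewrite -conjgM mulgKV -f0a // -hb /= ?fK //.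
by rewrite defQ1 imset_f.
Qed.

End Fusion.

Theorem theorem4p10 (gT : finGroupType) (p : nat) (P : {group gT})
    (F : hom_system gT) (p_pr : prime p) (pP : p.-group P)
    (satF : saturated p P F)
    (hP : (odd p /\ slim p P) \/ (p = 2 /\ D8_free P)) :
  eq_category P F P (Hom_P P)
  <-> eq_category 'N_P(P)%G (N_F F P) P (Hom_P P).
Proof.
have defN : 'N_P(P) = P by apply/setIidPl/normG.
have catF := sat_category satF.
have joinP (Q : {group gT}) : Q \subset P -> (P <*> Q)%G = P.
  by move=> sQP; apply/val_inj/joing_idPl.
split=> [[_ eqF] | [_ eqN]]; split=> // Q R f /=; rewrite ?defN => sQP sRP.
- rewrite /N_F eqF //; apply/andP/idP=> [[] | HomQR] //; split=> //.
  have /Hom_P_conjP[x Px [sQxR fx]] := HomQR.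
  apply/existsP; exists (finfun (fun u => u ^ x)); rewrite !joinP //.
  apply/and3P; split.
  + rewrite eqF //; apply/Hom_P_conjP; exists x => //; rewrite conjGid //.
    by split=> // u _; rewrite ffunE.
  + by apply/forall_inP=> u Qu; rewrite ffunE fx.
  by rewrite (eq_imset _ (ffunE _)) -[_ @: _]/(P :^ x) conjGid.
have HP g : F P P g -> Hom_P P P P g.
  have := eqN P P g; rewrite /= defN => <- // Fg; rewrite /N_F Fg /=.
  apply/existsP; exists (finfun g); rewrite joinP //; apply/and3P; split.
  - by rewrite (fcat_ext catF (g := g)) // => u _; rewrite ffunE.
  - by apply/forall_inP=> u _; rewrite ffunE.
  by rewrite (eq_imset _ (ffunE _)) (F_iso_card satF _ _ Fg).
have no_orbit (C E : {group gT}) x v :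
  C \subset P -> E \subset P -> x \in P -> ~ free_orbit p C E x v.
  move=> sCP sEP Px orb; case: hP => [[p_odd slimP] | [p2 freeP]].
    exact: free_orbit_slim (mem_p_elt pP Px) orb Px sEP slimP.
  by rewrite p2 in orb; apply: free_orbit_D8 orb Px sCP sEP freeP.
apply/idP/idP => [Ff | /(sat_conj satF) -> //].
have /Hom_P_conjP[x Px [_ fx]] :=
  F_trivial p_pr pP satF HP no_orbit sQP (F_widen satF sQP sRP Ff).
have [_ _ sfR] := fcat_injhom catF sQP sRP Ff.
apply/Hom_P_conjP; exists x => //; split=> //; apply: subset_trans sfR.
by apply/subsetP=> _ /imsetP[u Qu ->]; rewrite -fx // imset_f.
Qed.
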